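(* Let $k\ge0$, $T>0$. Assume that the system $$\rho_s+u\omega=0,\qquad \omega_s=\rho u,\qquad \omega=u_y,\qquad y\in I=(y_L,y_R),\ s\in[0,T],$$ with Dirichlet boundary condition has a smooth solution $u,\rho,\omega$. Let $u_h,\rho_h,\omega_h$ (functions of $s$ with values in $V_h^k$) be the numerical solution of the semi-discrete DG scheme: for all $\phi,\varphi,\psi\in V_h^k$ and all cells $I_j$, $1\le j\le N$, $$((\rho_h)_s,\phi)_{I_j}+(u_h\omega_h,\phi)_{I_j}=0,$$ $$((\omega_h)_s,\varphi)_{I_j}=(\rho_hu_h,\varphi)_{I_j},$$ $$(\omega_h,\psi)_{I_j}=\langle\widehat{u_h},\psi\rangle_{I_j}-(u_h,\psi_y)_{I_j},\qquad \widehat{u_h}=u_h^+,$$ and suppose that the initial data $u_h^0,\omega_h^0,\rho_h^0$ satisfy the approximation property $$\|u^0-u_h^0\|_{L^2(I)}+\|\rho^0-\rho_h^0\|_{L^2(I)}+\|\omega^0-\omega_h^0\|_{L^2(I)}\le Ch^{k+1}.$$ Then for regular triangulations of $I$ there holds, for $s\in[0,T]$, $$\|u-u_h\|_{L^2(I)}+\|\omega-\omega_h\|_{L^2(I)}+\|\rho-\rho_h\|_{L^2(I)}\le Ch^{k+1},$$ where the positive constant $C$ depends on the final time $T$ and the exact solutions (and not on $h$).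
   Context: The interval $I$ is partitioned into cells $I_j=[y_{j-1/2},y_{j+1/2}]$, $j=1,\dots,N$, with $y_{1/2}=y_L$, $y_{N+1/2}=y_R$, $\Delta y_j=y_{j+1/2}-y_{j-1/2}$, $h=\max_j\Delta y_j$. ''Regular triangulations'' means a family of such meshes for which $h/\min_j\Delta y_j$ is bounded uniformly, so that the inverse inequality $\big(\sum_{j=1}^N((v^-_{j+1/2})^2+(v^+_{j-1/2})^2)\big)^{1/2}\le\sigma h^{-1/2}\|v\|_{L^2(I)}$ for $v\in V_h^k$ holds with a constant $\sigma$ independent of $h$. $V_h^k$ is the space of functions $v$ on $I$ with $v|_{I_j}\in P^k(I_j)$ for all $j$ (polynomials of degree at most $k$ on each cell, possibly discontinuous across interfaces). $u^-_{j+1/2}$ and $u^+_{j+1/2}$ denote the values of $u$ at $y_{j+1/2}$ from the left cell $I_j$ and the right cell $I_{j+1}$; at the right endpoint the flux is given by the Dirichlet datum, $(u_h)^+_{N+1/2}=u(y_R,s)$. For each cell, $(u,v)_{I_j}=\int_{I_j}uv\,dy$ and $\langle\hat u,v\rangle_{I_j}=\hat u_{j+1/2}v^-_{j+1/2}-\hat u_{j-1/2}v^+_{j-1/2}$. The superscript $0$ denotes the value at initial time $s=0$; subscripts $s,y$ denote derivatives. *)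

(* Defs.v *)
From Stdlib Require Import Reals List RList.
From Coquelicot Require Import Coquelicot.
Open Scope R_scope.

(* f has derivative l at x relative to the set D; one-sided at an end point
   of a closed interval, two-sided at an interior point. *)
Definition has_deriv_in (D : R -> Prop) (f : R -> R) (x l : R) : Prop :=
  D_in f (fun _ => l) D x.

Definition Icc (a b : R) : R -> Prop := fun x => a <= x <= b.

(* C^infinity up to the boundary on [yL,yR] x [0,T]: D i j is the derivative
   of order i in y and j in s, and all of them are jointly continuous. *)
Definition smooth (yL yR T : R) (f : R -> R -> R) : Prop :=
  exists D : nat -> nat -> R -> R -> R,
    (forall y s, Icc yL yR y -> Icc 0 T s -> D 0%nat 0%nat y s = f y s) /\
    forall i j : nat,
      continuous_on (fun p : R * R => Icc yL yR (fst p) /\ Icc 0 T (snd p))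
        (fun p : R * R => D i j (fst p) (snd p)) /\
      forall y s, Icc yL yR y -> Icc 0 T s ->
        has_deriv_in (Icc yL yR) (fun z => D i j z s) y (D (S i) j y s) /\
        has_deriv_in (Icc 0 T) (fun t => D i j y t) s (D i (S j) y s).

(* g is the Dirichlet datum at yR, the boundary value which enters the scheme. *)
Record smooth_solution (yL yR T : R) (g : R -> R)
    (u rho omega : R -> R -> R) : Prop := {
  sol_smooth_u : smooth yL yR T u;
  sol_smooth_rho : smooth yL yR T rho;
  sol_smooth_omega : smooth yL yR T omega;
  sol_rho : forall y s, yL < y < yR -> Icc 0 T s ->
    has_deriv_in (Icc 0 T) (fun t => rho y t) s (- (u y s * omega y s));
  sol_omega : forall y s, yL < y < yR -> Icc 0 T s ->
    has_deriv_in (Icc 0 T) (fun t => omega y t) s (rho y s * u y s);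
  sol_u : forall y s, yL < y < yR -> Icc 0 T s ->
    has_deriv_in (Icc yL yR) (fun z => u z s) y (omega y s);
  sol_dirichlet : forall s, Icc 0 T s -> u yR s = g s
}.

(* node M j stands for y_{j+1/2}, so that the cell I_j, 1 <= j <= N, is
   [node M (j-1), node M j]. *)
Record mesh (yL yR : R) : Type := {
  ncells : nat;
  node : nat -> R;
  ncells_pos : (1 <= ncells)%nat;
  node_first : node 0%nat = yL;
  node_last : node ncells = yR;
  node_incr : forall j, (1 <= j <= ncells)%nat -> node (j - 1)%nat < node j
}.
Arguments ncells {yL yR} m.
Arguments node {yL yR} m j.

Section Scheme.
Context {yL yR : R} (M : mesh yL yR).

Definition is_cell (j : nat) : Prop := (1 <= j <= ncells M)%nat.
Definition cell (j : nat) : R -> Prop := Icc (node M (j - 1)) (node M j).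

Definition cell_sizes : list R :=
  map (fun j => node M j - node M (j - 1)) (seq 1 (ncells M)).
Definition hmax : R := MaxRlist cell_sizes.
Definition hmin : R := MinRlist cell_sizes.

(* A function on the partitioned interval, double-valued at the interfaces:
   v j is its restriction to the closed cell I_j, hence
   v^-_{j+1/2} = v j (node M j) and v^+_{j-1/2} = v j (node M (j-1)).
   Values of v j outside I_j are meaningless and are never used. *)
Definition broken : Type := nat -> R -> R.

Definition in_Vh (k : nat) (v : broken) : Prop :=
  forall j, is_cell j -> exists c : nat -> R,
    forall y, cell j y -> v j y = sum_n (fun i => c i * y ^ i) k.

Definition cell_inner (j : nat) (f g : R -> R) : R :=
  RInt (fun y => f y * g y) (node M (j - 1)) (node M j).

Definition L2norm (v : broken) : R :=
  sqrt (sum_n_m (fun j => cell_inner j (v j) (v j)) 1 (ncells M)).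

(* u - v, for u single-valued *)
Definition error (u : R -> R) (v : broken) : broken := fun j y => u y - v j y.

(* flux v b j is v^+_{j+1/2}, 0 <= j <= N, with b the datum at yR. *)
Definition flux (v : broken) (b : R) (j : nat) : R :=
  if Nat.eqb j (ncells M) then b else v (S j) (node M j).

Definition cell_bracket (j : nat) (vhat : nat -> R) (psi : broken) : R :=
  vhat j * psi j (node M j) - vhat (j - 1)%nat * psi j (node M (j - 1)).

(* uh s j y, rhoh s j y, omegah s j y : time, cell, point.  Differentiating a
   V_h^k-valued map in s is the same pointwise or coefficientwise. *)
Record dg_solution (k : nat) (T : R) (g : R -> R)
    (uh rhoh omegah : R -> broken) : Prop := {
  dg_in_Vh : forall s, Icc 0 T s ->
    in_Vh k (uh s) /\ in_Vh k (rhoh s) /\ in_Vh k (omegah s);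
  dg_evolution : exists rhoh_s omegah_s : R -> broken,
    (forall s j y, Icc 0 T s -> is_cell j -> cell j y ->
       has_deriv_in (Icc 0 T) (fun t => rhoh t j y) s (rhoh_s s j y) /\
       has_deriv_in (Icc 0 T) (fun t => omegah t j y) s (omegah_s s j y)) /\
    (forall s phi j, Icc 0 T s -> in_Vh k phi -> is_cell j ->
       cell_inner j (rhoh_s s j) (phi j)
       + cell_inner j (fun y => uh s j y * omegah s j y) (phi j) = 0) /\
    (forall s phi j, Icc 0 T s -> in_Vh k phi -> is_cell j ->
       cell_inner j (omegah_s s j) (phi j)
       = cell_inner j (fun y => rhoh s j y * uh s j y) (phi j));
  dg_constraint : forall s psi j, Icc 0 T s -> in_Vh k psi -> is_cell j ->
    cell_inner j (omegah s j) (psi j)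
    = cell_bracket j (flux (uh s) (g s)) psi
      - cell_inner j (uh s j) (Derive (psi j))
}.

Definition total_error (u rho omega : R -> R -> R) (uh rhoh omegah : R -> broken)
    (s : R) : R :=
  L2norm (error (fun y => u y s) (uh s))
  + L2norm (error (fun y => omega y s) (omegah s))
  + L2norm (error (fun y => rho y s) (rhoh s)).

End Scheme.

(* Main.v *)
(* Testing the constraint with constants determines the fluxes exactly,
   u(y_{j+1/2}) - \hat u_{j+1/2} being minus the integral of omega - omega_h over
   the cells to the right; local stability of the constraint on each cell then
   gives sup |u - u_h| <= K (|| omega - omega_h || + h^{k+1}) without any
   projection.  Let xi_o, xi_r be the differences between the cellwise Taylor
   polynomials of omega, rho and omega_h, rho_h.  In the time derivative of
   E = || xi_o ||^2 + || xi_r ||^2 the nonlinear products u_h xi_o xi_r of the two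
   evolution equations cancel, so E' <= C (E + h^{2k+2}) and Gronwall concludes. *)

Require Import Defs.
From Stdlib Require Import Reals List RList Lra Lia ClassicalEpsilon Factorial.
From Coquelicot Require Import Coquelicot.
Import ListNotations.
Open Scope R_scope.

(** * Finite sums and polynomials *)

(** The stability constant of a cell depends on the degree only. With p(y) = p(a) + (y - a) r(y), a
    suitable test function turns the constraint into a bound on the integral of (y - a) r(y)^2, and
    for polynomials of bounded degree this integral controls the coefficients of r with exactly the
    power of the cell size with which the data enter. Hence no negative power of h appears in
    passing to the sup norm. Taylor polynomials serve two purposes. Their coefficients are point
    values at a node, so their time derivatives are the Taylor polynomials of the time derivatives,
    and by the differential equations the residuals of the evolution equations are Taylor remainders
    again. They are also exact at the left node, where the upwind flux is the trace from the same
    cell, so the polynomial part of the error in u starts from the nodal error itself. *)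

Fixpoint bsum (f : nat -> R) (n : nat) : R :=
  match n with O => 0 | S m => bsum f m + f m end.

Lemma bsum_ext (f g : nat -> R) (n : nat) :
  (forall i, (i < n)%nat -> f i = g i) -> bsum f n = bsum g n.
Proof.
  induction n as [|n IH]; intros H; simpl; [reflexivity|].
  rewrite IH by (intros; apply H; lia); rewrite H by lia; reflexivity.
Qed.

Lemma bsum_plus (f g : nat -> R) (n : nat) :
  bsum (fun i => f i + g i) n = bsum f n + bsum g n.
Proof. induction n as [|n IH]; simpl; [|rewrite IH]; ring. Qed.

Lemma bsum_scal (a : R) (f : nat -> R) (n : nat) :
  bsum (fun i => a * f i) n = a * bsum f n.
Proof. induction n as [|n IH]; simpl; [|rewrite IH]; ring. Qed.

Lemma bsum_le (f g : nat -> R) (n : nat) :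
  (forall i, (i < n)%nat -> f i <= g i) -> bsum f n <= bsum g n.
Proof.
  induction n as [|n IH]; intros H; simpl; [lra|].
  apply Rplus_le_compat; [apply IH; intros; apply H; lia | apply H; lia].
Qed.

Lemma bsum_nonneg (f : nat -> R) (n : nat) :
  (forall i, (i < n)%nat -> 0 <= f i) -> 0 <= bsum f n.
Proof.
  induction n as [|n IH]; intros H; simpl; [lra|].
  assert (0 <= f n) by (apply H; lia).
  assert (0 <= bsum f n) by (apply IH; intros; apply H; lia); lra.
Qed.

Lemma bsum_le_extend (f : nat -> R) (m n : nat) :
  (m <= n)%nat -> (forall i, (i < n)%nat -> 0 <= f i) -> bsum f m <= bsum f n.
Proof.
  intros Hmn H; induction Hmn as [|n Hmn IH]; simpl; [lra|].
  assert (0 <= f n) by (apply H; lia).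
  assert (bsum f m <= bsum f n) by (apply IH; intros; apply H; lia); lra.
Qed.

Lemma bsum_term_le (f : nat -> R) (n i : nat) :
  (i < n)%nat -> (forall i, (i < n)%nat -> 0 <= f i) -> f i <= bsum f n.
Proof.
  intros Hi H.
  assert (A := bsum_le_extend f (S i) n Hi H); simpl in A.
  assert (0 <= bsum f i) by (apply bsum_nonneg; intros; apply H; lia); lra.
Qed.

Lemma bsum_telescope (f : nat -> R) (n : nat) :
  bsum (fun i => f (S i) - f i) n = f n - f 0%nat.
Proof. induction n as [|n IH]; simpl; [|rewrite IH]; ring. Qed.

(** Only the cross term [2 * P * x * y] of the induction step needs an argument: by the induction
    hypothesis its half has square at most [(A * y ^ 2) * (B * x ^ 2)], and the arithmetic-geometric
    mean inequality applies. *)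
Lemma bsum_cauchy_schwarz (f g : nat -> R) (n : nat) :
  (bsum (fun i => f i * g i) n) ^ 2
  <= bsum (fun i => f i ^ 2) n * bsum (fun i => g i ^ 2) n.
Proof.
  induction n as [|n IH]; cbn [bsum]; [lra|].
  set (A := bsum (fun i => f i ^ 2) n) in *.
  set (B := bsum (fun i => g i ^ 2) n) in *.
  set (P := bsum (fun i => f i * g i) n) in *.
  assert (HA : 0 <= A) by (apply bsum_nonneg; intros; apply pow2_ge_0).
  assert (HB : 0 <= B) by (apply bsum_nonneg; intros; apply pow2_ge_0).
  set (x := f n); set (y := g n); clearbody A B P x y.
  assert (HX : 0 <= A * y ^ 2) by (apply Rmult_le_pos; [|apply pow2_ge_0]; auto).
  assert (HY : 0 <= B * x ^ 2) by (apply Rmult_le_pos; [|apply pow2_ge_0]; auto).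
  assert (Q : (P * (x * y)) ^ 2 <= (A * y ^ 2) * (B * x ^ 2)).
  { replace ((P * (x * y)) ^ 2) with (P ^ 2 * (x * y) ^ 2) by ring.
    replace ((A * y ^ 2) * (B * x ^ 2)) with ((A * B) * (x * y) ^ 2) by ring.
    apply Rmult_le_compat_r; [apply pow2_ge_0 | exact IH]. }
  assert (2 * (P * (x * y)) <= A * y ^ 2 + B * x ^ 2).
  { set (z := P * (x * y)) in *; set (X := A * y ^ 2) in *.
    set (Y := B * x ^ 2) in *; clearbody z X Y.
    destruct (Rle_lt_dec (2 * z) (X + Y)) as [|G]; [assumption|exfalso].
    assert ((X + Y) * (X + Y) < (2 * z) * (2 * z))
      by (apply Rmult_le_0_lt_compat; lra).
    assert (0 <= (X - Y) ^ 2) by apply pow2_ge_0; lra. }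
  replace ((P + x * y) ^ 2) with (P ^ 2 + 2 * (P * (x * y)) + x ^ 2 * y ^ 2) by ring.
  replace ((A + x ^ 2) * (B + y ^ 2))
    with (A * B + (A * y ^ 2 + B * x ^ 2) + x ^ 2 * y ^ 2) by ring.
  lra.
Qed.

Lemma sum_n_bsum (f : nat -> R) (k : nat) : sum_n f k = bsum f (S k).
Proof.
  induction k as [|k IH]; [rewrite sum_O; simpl; ring|].
  rewrite sum_Sn, IH; reflexivity.
Qed.

(** The norm numbers the cells from 1. After this shift a cell is [S i] with [i < ncells M], and its
    end points are [node M i] and [node M (S i)]. *)
Lemma sum_n_m_bsum (f : nat -> R) (n : nat) :
  sum_n_m f 1 n = bsum (fun i => f (S i)) n.
Proof.
  induction n as [|n IH]; [rewrite sum_n_m_zero by lia; reflexivity|].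
  rewrite sum_n_Sm by lia; rewrite IH; reflexivity.
Qed.

(* Polynomials of degree < n, so that degree <= k is [psum _ (S k)] and the
   zero polynomial is [psum _ 0]. *)
Definition psum (c : nat -> R) (n : nat) (x : R) : R :=
  bsum (fun i => c i * x ^ i) n.

Definition is_poly (n : nat) (f : R -> R) : Prop :=
  exists c, forall x, f x = psum c n x.

Lemma is_poly_ext (n : nat) (f g : R -> R) :
  (forall x, f x = g x) -> is_poly n f -> is_poly n g.
Proof. intros E [c H]; exists c; intros; rewrite <- E; apply H. Qed.

Lemma is_poly_psum (c : nat -> R) (n : nat) : is_poly n (psum c n).
Proof. exists c; reflexivity. Qed.

Lemma is_poly_S (n : nat) (f : R -> R) : is_poly n f -> is_poly (S n) f.
Proof.
  intros [c H]; exists (fun i => if Nat.ltb i n then c i else 0); intros x.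
  rewrite H; unfold psum; simpl; rewrite Nat.ltb_irrefl, Rmult_0_l, Rplus_0_r.
  apply bsum_ext; intros i Hi; apply Nat.ltb_lt in Hi; rewrite Hi; reflexivity.
Qed.

Lemma is_poly_const (n : nat) (a : R) : is_poly (S n) (fun _ => a).
Proof.
  induction n as [|n IH]; [|apply is_poly_S, IH].
  exists (fun _ => a); intros x; unfold psum; simpl; ring.
Qed.

Lemma is_poly_plus (n : nat) (f g : R -> R) :
  is_poly n f -> is_poly n g -> is_poly n (fun x => f x + g x).
Proof.
  intros [c H] [d K]; exists (fun i => c i + d i); intros x.
  rewrite H, K; unfold psum; rewrite <- bsum_plus; apply bsum_ext; intros; ring.
Qed.

Lemma is_poly_scal (n : nat) (a : R) (f : R -> R) :
  is_poly n f -> is_poly n (fun x => a * f x).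
Proof.
  intros [c H]; exists (fun i => a * c i); intros x.
  rewrite H; unfold psum; rewrite <- bsum_scal; apply bsum_ext; intros; ring.
Qed.

Lemma psum_shift1 (c : nat -> R) (n : nat) (x : R) :
  psum c (S n) x = c 0%nat + x * psum (fun i => c (S i)) n x.
Proof.
  unfold psum; induction n as [|n IH]; [simpl; ring|].
  replace (bsum (fun i => c i * x ^ i) (S (S n)))
    with (bsum (fun i => c i * x ^ i) (S n) + c (S n) * x ^ S n) by reflexivity.
  rewrite IH; simpl; ring.
Qed.

Lemma is_poly_mulX (n : nat) (f : R -> R) :
  is_poly n f -> is_poly (S n) (fun x => x * f x).
Proof.
  intros [c H]; exists (fun i => match i with O => 0 | S j => c j end).
  intros x; rewrite psum_shift1, H; unfold psum; ring.
Qed.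

Lemma is_poly_mul_linear (n : nat) (a : R) (f : R -> R) :
  is_poly n f -> is_poly (S n) (fun x => (x - a) * f x).
Proof.
  intros H; apply (is_poly_ext _ (fun x => x * f x + (- a) * f x));
    [intros; ring|].
  apply is_poly_plus; [apply is_poly_mulX | apply is_poly_scal, is_poly_S]; auto.
Qed.

(** Horner's rule replaces the binomial expansion: removing the constant term leaves [x - a] times a
    polynomial with one coefficient fewer. *)
Lemma is_poly_translate (n : nat) (a : R) (f : R -> R) :
  is_poly n f -> is_poly n (fun x => f (x - a)).
Proof.
  intros [c H]; apply (is_poly_ext _ (fun x => psum c n (x - a)));
    [intros; rewrite H; reflexivity|].
  clear H f; revert c; induction n as [|n IH]; intros c.
  - exists c; reflexivity.
  - apply (is_poly_ext _
      (fun x => c 0%nat + (x - a) * psum (fun i => c (S i)) n (x - a)));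
      [intros; rewrite psum_shift1; reflexivity|].
    apply is_poly_plus; [apply is_poly_const|].
    apply is_poly_mul_linear, IH.
Qed.

Lemma is_poly_centered (n : nat) (a : R) (f : R -> R) :
  is_poly n f -> exists c, forall x, f x = psum c n (x - a).
Proof.
  intros H; destruct (is_poly_translate n (- a) f H) as [c Hc].
  exists c; intros x; rewrite <- Hc; f_equal; ring.
Qed.

(** Once f is expanded in powers of [x - a], division by [x - a] is a shift of the coefficients. *)
Lemma is_poly_quotient (n : nat) (a : R) (f : R -> R) :
  is_poly (S n) f ->
  exists r, is_poly n r /\ forall x, f x = f a + (x - a) * r x.
Proof.
  intros H; destruct (is_poly_centered _ a f H) as [c Hc].
  exists (fun x => psum (fun i => c (S i)) n (x - a)); split.
  - apply (is_poly_translate n a (psum (fun i => c (S i)) n)), is_poly_psum.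
  - intros x; rewrite !Hc, !psum_shift1; ring.
Qed.

(** The basis is built node by node. For a new node [p n], write f = f(p n) + (x - p n) r and
    interpolate r at the old nodes, where r is a divided difference of f. Collecting the factor of
    each [f (p m)] gives [w m]; the factor of [f (p n)] is 1 minus the sum of these. *)
Lemma is_poly_interpolation (n : nat) (p : nat -> R) :
  (forall i j, (i < n)%nat -> (j < n)%nat -> p i = p j -> i = j) ->
  exists l : nat -> R -> R, (forall m, (m < n)%nat -> is_poly n (l m)) /\
    forall f, is_poly n f -> forall x, f x = bsum (fun m => f (p m) * l m x) n.
Proof.
  induction n as [|n IH]; intros inj.
  - exists (fun _ _ => 0); split; [lia | intros f [c H] x; rewrite H; reflexivity].
  - destruct IH as [l [Hl Hf]]; [intros i j Hi Hj; apply inj; lia|].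
    set (w := fun m x => (x - p n) * (/ (p m - p n) * l m x)).
    assert (Hw : forall m, (m < n)%nat -> is_poly (S n) (w m)).
    { intros m Hm; apply is_poly_mul_linear, is_poly_scal, Hl, Hm. }
    exists (fun m x => if Nat.eqb m n then 1 + -1 * bsum (fun i => w i x) n else w m x).
    split.
    + intros m Hm; destruct (Nat.eqb_spec m n) as [->|Hne]; [|apply Hw; lia].
      apply is_poly_plus; [apply is_poly_const | apply is_poly_scal].
      assert (G : forall q, (q <= n)%nat -> is_poly (S n) (fun x => bsum (fun i => w i x) q)).
      { induction q as [|q IHq]; intros Hq; simpl; [apply is_poly_const|].
        apply is_poly_plus; [apply IHq | apply Hw]; lia. }
      apply G; lia.
    + intros f H x; simpl; rewrite Nat.eqb_refl.
      destruct (is_poly_quotient n (p n) f H) as [r [Hr E]].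
      rewrite (E x) at 1; rewrite (Hf r Hr x).
      rewrite <- bsum_scal, Rmult_plus_distr_l, Rmult_1_r.
      rewrite (bsum_ext (fun m => f (p m) * _)
        (fun m => (x - p n) * (r (p m) * l m x) + f (p n) * w m x)).
      * rewrite bsum_plus, !bsum_scal; ring.
      * intros m Hm; destruct (Nat.eqb_spec m n) as [->|Hne]; [lia|].
        rewrite (E (p m)); unfold w.
        assert (p m - p n <> 0).
        { intros Z; apply Hne, inj; [lia | lia | lra]. }
        field; auto.
Qed.

(** * One-sided derivatives, continuity and integrals on closed intervals *)

(* [RInt] lands in [R] only up to conversion, which [ring] and [field] do not see. *)
Ltac eq_in_R := match goal with |- ?x = ?y => change (@eq R x y) end.

Lemma has_deriv_in_ext (D : R -> Prop) (f g : R -> R) (x l : R) :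
  (forall y, D y -> f y = g y) -> D x ->
  has_deriv_in D f x l -> has_deriv_in D g x l.
Proof.
  intros E Dx H eps He; destruct (H eps He) as [d [Hd K]].
  exists d; split; [exact Hd|]; intros y [[Dy Hy] Hlt].
  rewrite <- !E by assumption; apply K; repeat split; assumption.
Qed.

Lemma has_deriv_in_sub (D D' : R -> Prop) (f : R -> R) (x l : R) :
  (forall y, D' y -> D y) -> has_deriv_in D f x l -> has_deriv_in D' f x l.
Proof. apply D_in_imp. Qed.

Lemma has_deriv_in_plus (D : R -> Prop) (f g : R -> R) (x l m : R) :
  has_deriv_in D f x l -> has_deriv_in D g x m ->
  has_deriv_in D (fun y => f y + g y) x (l + m).
Proof. apply (Dadd D (fun _ => l) (fun _ => m)). Qed.

Lemma has_deriv_in_mult (D : R -> Prop) (f g : R -> R) (x l m : R) :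
  has_deriv_in D f x l -> has_deriv_in D g x m ->
  has_deriv_in D (fun y => f y * g y) x (l * g x + f x * m).
Proof.
  intros F G eps He.
  destruct (Dmult D (fun _ => l) (fun _ => m) f g x F G eps He) as [d Hd].
  exists d; exact Hd.
Qed.

Lemma has_deriv_in_is_derive (D : R -> Prop) (f : R -> R) (x l : R) :
  is_derive f x l -> has_deriv_in D f x l.
Proof.
  intros H; apply is_derive_Reals in H.
  apply (D_in_imp f (fun _ => l) no_cond); [intros; exact I|].
  apply (derivable_pt_lim_D_in f (fun _ => l) x); exact H.
Qed.

Lemma has_deriv_in_const (D : R -> Prop) (c x : R) :
  has_deriv_in D (fun _ => c) x 0.
Proof. apply has_deriv_in_is_derive; auto_derive; auto. Qed.

Lemma has_deriv_in_scal (D : R -> Prop) (a : R) (f : R -> R) (x l : R) :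
  has_deriv_in D f x l -> has_deriv_in D (fun y => a * f y) x (a * l).
Proof.
  intros H; replace (a * l) with (0 * f x + a * l) by ring.
  apply (has_deriv_in_mult D (fun _ => a) f x 0 l); [apply has_deriv_in_const | exact H].
Qed.

Lemma has_deriv_in_minus (D : R -> Prop) (f g : R -> R) (x l m : R) :
  has_deriv_in D f x l -> has_deriv_in D g x m ->
  has_deriv_in D (fun y => f y - g y) x (l - m).
Proof.
  intros F G; replace (l - m) with (l + -1 * m) by ring.
  apply (has_deriv_in_plus D f (fun y => - g y)); [exact F|].
  intros eps He; destruct (has_deriv_in_scal D (-1) g x m G eps He) as [d [Hd K]].
  exists d; split; [exact Hd|]; intros y Hy.
  replace (- g y - - g x) with (-1 * g y - -1 * g x) by ring; apply K, Hy.
Qed.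

Lemma has_deriv_in_bsum (D : R -> Prop) (f : nat -> R -> R) (l : nat -> R)
    (n : nat) (x : R) :
  (forall i, (i < n)%nat -> has_deriv_in D (f i) x (l i)) ->
  has_deriv_in D (fun y => bsum (fun i => f i y) n) x (bsum l n).
Proof.
  induction n as [|n IH]; intros H; simpl; [apply has_deriv_in_const|].
  apply has_deriv_in_plus; [apply IH; intros; apply H; lia | apply H; lia].
Qed.

(** Uniqueness of the limit needs points of the interval other than x arbitrarily close to x: they
    are taken to the left if x is the right end point and to the right otherwise. *)
Lemma has_deriv_in_unique (a b : R) (f : R -> R) (x l m : R) :
  a < b -> Icc a b x ->
  has_deriv_in (Icc a b) f x l -> has_deriv_in (Icc a b) f x m -> l = m.
Proof.
  intros Hab [H1 H2] F G.
  refine (single_limit _ (D_x (Icc a b) x) l m x _ F G).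
  intros d Hd; destruct (Rle_lt_dec b x) as [Hb|Hb].
  - assert (0 < Rmin (d / 2) (x - a)) by (apply Rmin_pos; lra).
    assert (Q1 := Rmin_l (d / 2) (x - a)); assert (Q2 := Rmin_r (d / 2) (x - a)).
    exists (x - Rmin (d / 2) (x - a)); split; [split; [split|]; lra|].
    unfold Rdist; rewrite Rabs_left; lra.
  - assert (0 < Rmin (d / 2) (b - x)) by (apply Rmin_pos; lra).
    assert (Q1 := Rmin_l (d / 2) (b - x)); assert (Q2 := Rmin_r (d / 2) (b - x)).
    exists (x + Rmin (d / 2) (b - x)); split; [split; [split|]; lra|].
    unfold Rdist; rewrite Rabs_pos_eq; lra.
Qed.

Lemma is_derive_of_has_deriv_in (a b : R) (f : R -> R) (x l : R) :
  a < x < b -> has_deriv_in (Icc a b) f x l -> is_derive f x l.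
Proof.
  intros Hx H; apply is_derive_Reals.
  apply (derivable_pt_lim_D_in f (fun _ => l) x); intros eps He.
  destruct (H eps He) as [d [Hd K]].
  set (m := Rmin d (Rmin (x - a) (b - x))).
  assert (0 < m) by (repeat apply Rmin_pos; lra).
  assert (m <= d) by apply Rmin_l.
  assert (m <= Rmin (x - a) (b - x)) by apply Rmin_r.
  assert (Q1 := Rmin_l (x - a) (b - x)); assert (Q2 := Rmin_r (x - a) (b - x)).
  exists m; split; [assumption|]; intros y [[_ Hy] Hlt]; apply K.
  simpl in Hlt |- *; split; [split; [|exact Hy] | lra].
  unfold Rdist in Hlt; apply Rabs_def2 in Hlt; split; lra.
Qed.

(** The 1-Lipschitz retraction of the line onto [a, b]; composing with it extends a function
    continuous on [a, b] to a continuous function on the line. *)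
Definition clamp (a b y : R) : R := Rmax a (Rmin b y).

Lemma clamp_in (a b y : R) : a <= b -> Icc a b (clamp a b y).
Proof.
  intros H; split; [apply Rmax_l | apply Rmax_lub; [exact H | apply Rmin_l]].
Qed.

Lemma clamp_id (a b y : R) : Icc a b y -> clamp a b y = y.
Proof.
  intros [H K]; unfold clamp; rewrite Rmin_right, Rmax_right; auto.
Qed.

Lemma clamp_lipschitz (a b x y : R) :
  Rabs (clamp a b y - clamp a b x) <= Rabs (y - x).
Proof.
  unfold clamp, Rmax, Rmin; repeat destruct Rle_dec; unfold Rabs;
    repeat destruct Rcase_abs; lra.
Qed.

(* Continuity on the closed interval, in a form which gives Riemann
   integrability without looking at one-sided limits. *)
Definition cont_Icc (a b : R) (f : R -> R) : Prop :=
  exists g, (forall x, continuous g x) /\ forall x, Icc a b x -> f x = g x.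

Lemma cont_Icc_of_eps (a b : R) (f : R -> R) :
  a <= b ->
  (forall x, Icc a b x -> forall eps, 0 < eps -> exists d, 0 < d /\
     forall y, Icc a b y -> Rabs (y - x) < d -> Rabs (f y - f x) < eps) ->
  cont_Icc a b f.
Proof.
  intros Hab H; exists (fun x => f (clamp a b x)); split.
  - intros x; apply continuity_pt_filterlim; intros eps He.
    destruct (H (clamp a b x) (clamp_in a b x Hab) eps He) as [d [Hd K]].
    exists d; split; [exact Hd|]; intros y [_ Hy].
    apply K; [apply clamp_in, Hab|].
    eapply Rle_lt_trans; [apply clamp_lipschitz | exact Hy].
  - intros x Hx; rewrite clamp_id; auto.
Qed.

Lemma cont_Icc_of_has_deriv_in (a b : R) (f df : R -> R) :
  a <= b -> (forall x, Icc a b x -> has_deriv_in (Icc a b) f x (df x)) ->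
  cont_Icc a b f.
Proof.
  intros Hab H; apply cont_Icc_of_eps; [exact Hab|]; intros x Hx eps He.
  destruct (cont_deriv _ _ _ _ (H x Hx) eps He) as [d [Hd K]].
  exists d; split; [exact Hd|]; intros y Hy Hlt.
  destruct (Req_dec y x) as [->|Hne].
  - unfold Rminus; rewrite Rplus_opp_r, Rabs_R0; exact He.
  - apply (K y); split; [split; [exact Hy | exact (not_eq_sym Hne)] | exact Hlt].
Qed.

Lemma cont_Icc_ext (a b : R) (f g : R -> R) :
  (forall x, Icc a b x -> f x = g x) -> cont_Icc a b f -> cont_Icc a b g.
Proof.
  intros E [h [C H]]; exists h; split; [exact C|].
  intros x Hx; rewrite <- E by exact Hx; auto.
Qed.

Lemma cont_Icc_sub (a b c d : R) (f : R -> R) :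
  a <= c -> d <= b -> cont_Icc a b f -> cont_Icc c d f.
Proof.
  intros H K [g [C E]]; exists g; split; [exact C|].
  intros x [X Y]; apply E; split; lra.
Qed.

Lemma cont_Icc_const (a b c : R) : cont_Icc a b (fun _ => c).
Proof.
  exists (fun _ => c); split; [intros; apply continuous_const | reflexivity].
Qed.

Lemma cont_Icc_plus (a b : R) (f g : R -> R) :
  cont_Icc a b f -> cont_Icc a b g -> cont_Icc a b (fun x => f x + g x).
Proof.
  intros [f' [C E]] [g' [C' E']]; exists (fun x => f' x + g' x); split.
  - intros x; apply (continuous_plus f' g'); auto.
  - intros x Hx; rewrite E, E'; auto.
Qed.

Lemma cont_Icc_mult (a b : R) (f g : R -> R) :
  cont_Icc a b f -> cont_Icc a b g -> cont_Icc a b (fun x => f x * g x).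
Proof.
  intros [f' [C E]] [g' [C' E']]; exists (fun x => f' x * g' x); split.
  - intros x; apply (continuous_mult f' g'); auto.
  - intros x Hx; rewrite E, E'; auto.
Qed.

Lemma cont_Icc_opp (a b : R) (f : R -> R) :
  cont_Icc a b f -> cont_Icc a b (fun x => - f x).
Proof.
  intros H; apply (cont_Icc_ext _ _ (fun x => -1 * f x)); [intros; ring|].
  apply cont_Icc_mult; [apply cont_Icc_const | exact H].
Qed.

Lemma cont_Icc_minus (a b : R) (f g : R -> R) :
  cont_Icc a b f -> cont_Icc a b g -> cont_Icc a b (fun x => f x - g x).
Proof.
  intros F G; apply (cont_Icc_plus a b f (fun x => - g x)); [exact F|].
  apply cont_Icc_opp, G.
Qed.

Lemma cont_Icc_abs (a b : R) (f : R -> R) :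
  cont_Icc a b f -> cont_Icc a b (fun x => Rabs (f x)).
Proof.
  intros [f' [C E]]; exists (fun x => Rabs (f' x)); split.
  - intros x; apply (continuous_comp f' Rabs); [auto | apply continuous_Rabs].
  - intros x Hx; rewrite E; auto.
Qed.

Lemma cont_Icc_id (a b : R) : cont_Icc a b (fun x => x).
Proof.
  exists (fun x => x); split; [intros; apply continuous_id | reflexivity].
Qed.

Lemma cont_Icc_pow (a b : R) (f : R -> R) (n : nat) :
  cont_Icc a b f -> cont_Icc a b (fun x => f x ^ n).
Proof.
  intros H; induction n as [|n IH]; [exact (cont_Icc_const a b 1)|].
  apply (cont_Icc_mult a b f (fun x => f x ^ n)); assumption.
Qed.

Lemma cont_Icc_bsum (a b : R) (f : nat -> R -> R) (n : nat) :
  (forall i, (i < n)%nat -> cont_Icc a b (f i)) ->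
  cont_Icc a b (fun x => bsum (fun i => f i x) n).
Proof.
  induction n as [|n IH]; intros H; simpl; [apply cont_Icc_const|].
  apply cont_Icc_plus; [apply IH; intros; apply H; lia | apply H; lia].
Qed.

Lemma cont_Icc_psum (a b : R) (c : nat -> R) (n : nat) (f : R -> R) :
  cont_Icc a b f -> cont_Icc a b (fun x => psum c n (f x)).
Proof.
  intros H; apply (cont_Icc_bsum a b (fun i x => c i * f x ^ i)).
  intros; apply cont_Icc_mult; [apply cont_Icc_const | apply cont_Icc_pow, H].
Qed.

Lemma cont_Icc_is_poly (a b : R) (n : nat) (f : R -> R) :
  is_poly n f -> cont_Icc a b f.
Proof.
  intros [c H]; apply (cont_Icc_ext _ _ (psum c n)); [intros; auto|].
  apply (cont_Icc_psum a b c n (fun x => x)), cont_Icc_id.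
Qed.

Lemma ex_RInt_cont_Icc (a b : R) (f : R -> R) :
  a <= b -> cont_Icc a b f -> ex_RInt f a b.
Proof.
  intros Hab [g [C E]]; apply (ex_RInt_ext g).
  - intros x Hx; rewrite Rmin_left, Rmax_right in Hx by exact Hab.
    symmetry; apply E; split; lra.
  - apply (ex_RInt_continuous (V := R_CompleteNormedModule)); auto.
Qed.

Lemma RInt_cont_plus (a b : R) (f g : R -> R) :
  a <= b -> cont_Icc a b f -> cont_Icc a b g ->
  RInt (fun x => f x + g x) a b = RInt f a b + RInt g a b.
Proof. intros; apply (RInt_plus f g); apply ex_RInt_cont_Icc; assumption. Qed.

Lemma RInt_cont_minus (a b : R) (f g : R -> R) :
  a <= b -> cont_Icc a b f -> cont_Icc a b g ->
  RInt (fun x => f x - g x) a b = RInt f a b - RInt g a b.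
Proof. intros; apply (RInt_minus f g); apply ex_RInt_cont_Icc; assumption. Qed.

Lemma RInt_cont_scal (a b l : R) (f : R -> R) :
  a <= b -> cont_Icc a b f -> RInt (fun x => l * f x) a b = l * RInt f a b.
Proof. intros; apply (RInt_scal f); apply ex_RInt_cont_Icc; assumption. Qed.

Lemma RInt_cont_ext (a b : R) (f g : R -> R) :
  a <= b -> (forall x, a < x < b -> f x = g x) -> RInt f a b = RInt g a b.
Proof.
  intros Hab H; apply RInt_ext; intros x Hx.
  rewrite Rmin_left, Rmax_right in Hx by exact Hab; auto.
Qed.

Lemma RInt_cont_le (a b : R) (f g : R -> R) :
  a <= b -> cont_Icc a b f -> cont_Icc a b g ->
  (forall x, a < x < b -> f x <= g x) -> RInt f a b <= RInt g a b.
Proof. intros; apply RInt_le; auto; apply ex_RInt_cont_Icc; assumption. Qed.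

Lemma RInt_const_R (a b c : R) : RInt (fun _ => c) a b = (b - a) * c.
Proof. exact (RInt_const (V := R_CompleteNormedModule) a b c). Qed.

Lemma RInt_cont_nonneg (a b : R) (f : R -> R) :
  a <= b -> cont_Icc a b f -> (forall x, a < x < b -> 0 <= f x) ->
  0 <= RInt f a b.
Proof.
  intros Hab C H; rewrite <- (Rmult_0_r (b - a)), <- RInt_const_R.
  apply RInt_cont_le; auto; apply cont_Icc_const.
Qed.

Lemma RInt_cont_abs_le (a b B : R) (f : R -> R) :
  a <= b -> cont_Icc a b f -> (forall x, a < x < b -> Rabs (f x) <= B) ->
  Rabs (RInt f a b) <= (b - a) * B.
Proof.
  intros Hab C H.
  eapply Rle_trans; [apply abs_RInt_le; [exact Hab | apply ex_RInt_cont_Icc; auto]|].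
  rewrite <- RInt_const_R; apply RInt_cont_le; auto.
  - apply cont_Icc_abs, C.
  - apply cont_Icc_const.
Qed.

Lemma RInt_bsum_mult (a b : R) (al : nat -> R) (l : nat -> R -> R) (w : R -> R)
    (n : nat) :
  a <= b -> (forall m, (m < n)%nat -> cont_Icc a b (l m)) -> cont_Icc a b w ->
  RInt (fun x => bsum (fun m => al m * l m x) n * w x) a b
  = bsum (fun m => al m * RInt (fun x => l m x * w x) a b) n.
Proof.
  intros Hab Hl Hw; induction n as [|n IH]; simpl.
  - rewrite (RInt_ext _ (fun _ => 0)) by (intros; apply Rmult_0_l).
    rewrite RInt_const_R; ring.
  - rewrite <- IH by (intros; apply Hl; lia).
    rewrite <- RInt_cont_scal, <- RInt_cont_plus; auto.
    + apply RInt_cont_ext; [exact Hab | intros; ring].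
    + apply cont_Icc_mult; [|exact Hw].
      apply (cont_Icc_bsum a b (fun m x => al m * l m x)); intros m Hm.
      apply cont_Icc_mult; [apply cont_Icc_const | apply Hl; lia].
    + apply cont_Icc_mult; [apply cont_Icc_const|].
      apply cont_Icc_mult; [apply Hl; lia | exact Hw].
    + apply cont_Icc_mult; [apply Hl; lia | exact Hw].
Qed.

(** The integral of (|f| - t)^2 is a nonnegative quadratic in t; its value at the minimiser, the
    mean [I / (b - a)] of |f|, is the claim. The case a = b is separate because of this quotient. *)
Lemma RInt_cauchy_schwarz (a b : R) (f : R -> R) :
  a <= b -> cont_Icc a b f ->
  RInt (fun x => Rabs (f x)) a b
  <= sqrt (b - a) * sqrt (RInt (fun x => f x * f x) a b).
Proof.
  intros Hab C; rewrite <- sqrt_mult_alt by lra.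
  set (I := RInt (fun x => Rabs (f x)) a b).
  set (J := RInt (fun x => f x * f x) a b).
  assert (CA := cont_Icc_abs a b f C).
  assert (CF : cont_Icc a b (fun x => f x * f x)) by (apply cont_Icc_mult; auto).
  assert (HI : 0 <= I) by (apply RInt_cont_nonneg; auto; intros; apply Rabs_pos).
  assert (G : forall t, 0 <= J - 2 * t * I + (b - a) * t ^ 2).
  { intros t; unfold I, J.
    rewrite <- (RInt_const_R a b (t ^ 2)), <- RInt_cont_scal, <- RInt_cont_minus,
      <- RInt_cont_plus; auto using cont_Icc_const, cont_Icc_mult.
    - apply RInt_cont_nonneg; auto.
      + apply cont_Icc_plus; [apply cont_Icc_minus|]; auto using cont_Icc_const, cont_Icc_mult.
      + intros x _; replace (f x * f x) with (Rabs (f x) * Rabs (f x))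
          by (rewrite <- Rabs_mult; apply Rabs_pos_eq; apply Rle_0_sqr).
        assert (0 <= (Rabs (f x) - t) ^ 2) by apply pow2_ge_0; lra.
    - apply cont_Icc_minus; auto using cont_Icc_const, cont_Icc_mult. }
  rewrite <- (sqrt_pow2 I HI); apply sqrt_le_1_alt.
  destruct (Req_dec a b) as [E|E].
  - assert (I = 0) by (unfold I; rewrite E; exact (RInt_point (V := R_CompleteNormedModule) b _)).
    rewrite H; replace (b - a) with 0 by lra; lra.
  - assert (P : 0 < b - a) by lra.
    specialize (G (I / (b - a))).
    replace (J - 2 * (I / (b - a)) * I + (b - a) * (I / (b - a)) ^ 2)
      with (((b - a) * J - I ^ 2) / (b - a)) in G by (field; lra).
    assert (0 * (b - a) <= ((b - a) * J - I ^ 2) / (b - a) * (b - a))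
      by (apply Rmult_le_compat_r; lra).
    replace (((b - a) * J - I ^ 2) / (b - a) * (b - a)) with ((b - a) * J - I ^ 2)
      in H by (field; lra).
    lra.
Qed.

(** The classical theorem is applied to a continuous extension of F, since F may be arbitrary
    outside [a, b]. *)
Lemma mean_value_Icc (a b : R) (F dF : R -> R) :
  a <= b -> (forall x, Icc a b x -> has_deriv_in (Icc a b) F x (dF x)) ->
  exists c, Icc a b c /\ F b - F a = dF c * (b - a).
Proof.
  intros Hab H.
  destruct (cont_Icc_of_has_deriv_in a b F dF Hab H) as [G [C E]].
  destruct (MVT_gen G a b dF) as [c [Hc K]].
  - intros x Hx; rewrite Rmin_left, Rmax_right in Hx by exact Hab.
    apply (is_derive_of_has_deriv_in a b); [exact Hx|].
    apply (has_deriv_in_ext _ F); [exact E | split; lra | apply H; split; lra].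
  - intros x _; apply continuity_pt_filterlim, C.
  - rewrite Rmin_left, Rmax_right in Hc by exact Hab.
    exists c; split; [exact Hc|].
    rewrite !E by (split; lra); exact K.
Qed.

(** The continuous extension g of f has a primitive differentiable at the end points too, so F minus
    that primitive has derivative f - g = 0 on the closed interval and the mean value theorem makes
    it constant. *)
Lemma fundamental_theorem_Icc (a b : R) (F f : R -> R) :
  a <= b -> cont_Icc a b f ->
  (forall x, Icc a b x -> has_deriv_in (Icc a b) F x (f x)) ->
  RInt f a b = F b - F a.
Proof.
  intros Hab [g [C E]] H.
  set (G := fun x => RInt g a x).
  destruct (mean_value_Icc a b (fun x => F x - G x) (fun x => f x - g x) Hab)
    as [c [Hc K]].
  - intros x Hx; apply has_deriv_in_minus; [apply H, Hx|].
    apply has_deriv_in_is_derive, (is_derive_RInt g G a x); [|apply C].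
    exists (mkposreal 1 Rlt_0_1); intros y _; apply (RInt_correct (V := R_CompleteNormedModule) g a y).
    apply (ex_RInt_continuous (V := R_CompleteNormedModule)); auto.
  - rewrite E in K by exact Hc.
    assert (G a = 0) by exact (RInt_point (V := R_CompleteNormedModule) a g).
    rewrite (RInt_cont_ext a b f g); [fold (G b); lra | exact Hab|].
    intros x Hx; apply E; split; lra.
Qed.

(** * An inverse inequality for polynomials *)

Lemma psum_abs_le (c : nat -> R) (n : nat) (x h : R) :
  Rabs x <= h -> Rabs (psum c n x) <= psum (fun i => Rabs (c i)) n h.
Proof.
  intros H; unfold psum; induction n as [|n IH]; simpl; [rewrite Rabs_R0; lra|].
  eapply Rle_trans; [apply Rabs_triang|]; apply Rplus_le_compat; [exact IH|].
  rewrite Rabs_mult, <- RPow_abs; apply Rmult_le_compat_l; [apply Rabs_pos|].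
  apply pow_incr; split; [apply Rabs_pos | exact H].
Qed.

Lemma psum_abs_nonneg (c : nat -> R) (n : nat) (h : R) :
  0 <= h -> 0 <= psum (fun i => Rabs (c i)) n h.
Proof.
  intros H; apply bsum_nonneg; intros; apply Rmult_le_pos;
    [apply Rabs_pos | apply pow_le, H].
Qed.

Lemma is_derive_psum (c : nat -> R) (n : nat) (a x : R) :
  is_derive (fun y => psum c (S n) (y - a)) x
    (psum (fun i => INR (S i) * c (S i)) n (x - a)).
Proof.
  induction n as [|n IH].
  - unfold psum; simpl; auto_derive; auto; ring.
  - replace (psum (fun i => INR (S i) * c (S i)) (S n) (x - a))
      with (psum (fun i => INR (S i) * c (S i)) n (x - a)
            + INR (S n) * c (S n) * (x - a) ^ n) by reflexivity.
    apply (is_derive_plus (fun y => psum c (S n) (y - a))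
             (fun y => c (S n) * (y - a) ^ S n)); [exact IH|].
    auto_derive; [exact I|]; change (match n with 0%nat => 1 | S _ => INR n + 1 end) with (INR (S n)); unfold Rminus; ring.
Qed.

Lemma RInt_pow_0 (h : R) (m : nat) :
  0 <= h -> RInt (fun x => x ^ m) 0 h = h ^ S m / INR (S m).
Proof.
  intros Hh; assert (N : INR (S m) <> 0) by (apply not_0_INR; lia).
  rewrite (fundamental_theorem_Icc 0 h (fun x => x ^ S m / INR (S m))).
  - rewrite pow_i by lia; eq_in_R; field; exact N.
  - exact Hh.
  - apply cont_Icc_pow, cont_Icc_id.
  - intros x _; apply has_deriv_in_is_derive; auto_derive; [exact I|].
    change (match m with 0%nat => 1 | S _ => INR m + 1 end) with (INR (S m)); field; exact N.
Qed.

(** Substituting x = 2t gives four times the integral over the first half of the interval, one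
    factor 2 coming from dx and one from the weight; the other half contributes a nonnegative
    amount. *)
Lemma RInt_half_dilation (h : R) (p : R -> R) :
  0 <= h -> cont_Icc 0 h p ->
  RInt (fun x => x * p (x / 2) ^ 2) 0 h <= 4 * RInt (fun x => x * p x ^ 2) 0 h.
Proof.
  intros Hh C.
  set (F := fun x => x * p x ^ 2).
  assert (CF : cont_Icc 0 h F)
    by (apply cont_Icc_mult; [apply cont_Icc_id | apply cont_Icc_pow, C]).
  assert (X1 : ex_RInt F 0 (h / 2))
    by (apply ex_RInt_cont_Icc; [lra | apply (cont_Icc_sub 0 h); auto; lra]).
  assert (X2 : ex_RInt F (h / 2) h)
    by (apply ex_RInt_cont_Icc; [lra | apply (cont_Icc_sub 0 h); auto; lra]).
  assert (E : RInt (fun x => x * p (x / 2) ^ 2) 0 h = 4 * RInt F 0 (h / 2)).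
  { assert (X : ex_RInt F (/ 2 * 0 + 0) (/ 2 * h + 0)).
    { replace (/ 2 * 0 + 0) with 0 by ring.
      replace (/ 2 * h + 0) with (h / 2) by field; exact X1. }
    assert (L := RInt_comp_lin (V := R_CompleteNormedModule) F (/ 2) 0 0 h X).
    replace (/ 2 * 0 + 0) with 0 in L by ring.
    replace (/ 2 * h + 0) with (h / 2) in L by field.
    rewrite <- L.
    assert (Y : ex_RInt (fun y : R => scal (/ 2) (F (/ 2 * y + 0))) 0 h)
      by (apply (ex_RInt_comp_lin (V := R_CompleteNormedModule) F); exact X).
    assert (Z := RInt_scal (V := R_CompleteNormedModule) _ 0 h 4 Y).
    etransitivity; [|exact Z].
    apply RInt_cont_ext; [exact Hh|]; intros x _; unfold F, scal; simpl.
    unfold mult; simpl; replace (/ 2 * x + 0) with (x / 2) by field; eq_in_R; field. }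
  rewrite E; apply Rmult_le_compat_l; [lra|].
  assert (P := RInt_Chasles (V := R_CompleteNormedModule) F 0 (h / 2) h X1 X2).
  change (RInt F 0 (h / 2) + RInt F (h / 2) h = RInt F 0 h) in P.
  assert (0 <= RInt F (h / 2) h); [|lra].
  apply RInt_cont_nonneg; [lra | apply (cont_Icc_sub 0 h); auto; lra|].
  intros x Hx; apply Rmult_le_pos; [lra | apply pow2_ge_0].
Qed.

(* [p x - 2^n p (x/2)] has no term of degree n, which allows an induction on
   the degree: its coefficients dominate the lower ones of p. *)
Lemma poly_inverse_inequality_0 (n : nat) :
  exists K, 0 <= K /\ forall (h : R) (c : nat -> R), 0 < h ->
    h ^ 2 * psum (fun i => Rabs (c i)) n h ^ 2
    <= K * RInt (fun x => x * psum c n x ^ 2) 0 h.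
Proof.
  induction n as [|n [K [HK IH]]].
  - exists 0; split; [lra|]; intros h c _; unfold psum; simpl; lra.
  (* The 2 comes from (p - q)^2 <= 2 p^2 + 2 q^2 with q = 2^n p(x/2), and 8 is 2 times the factor 4
     of [RInt_half_dilation]. *)
  - set (A := K * (2 + 8 * (2 ^ n) ^ 2)).
    (* The first summand pays for the lower coefficients, the second for the leading one;
       [2 * INR n + 2] is the reciprocal of the integral of x^(2n+1) over [0, 1]. *)
    exists (2 * A + 2 * ((2 * INR n + 2) * (2 + A))).
    assert (Hn := pos_INR n).
    assert (HA : 0 <= A).
    { apply Rmult_le_pos; [exact HK|].
      assert (0 <= (2 ^ n) ^ 2) by apply pow2_ge_0; lra. }
    split.
    { assert (0 <= (2 * INR n + 2) * (2 + A)) by (apply Rmult_le_pos; lra); lra. }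
    intros h c Hh.
    set (p := psum c (S n)); set (J := RInt (fun x => x * p x ^ 2) 0 h).
    set (d := fun i => c i * (1 - 2 ^ n * (/ 2) ^ i)).
    assert (Cp : forall m e, cont_Icc 0 h (fun x => psum e m x))
      by (intros; apply (cont_Icc_psum 0 h e m (fun x => x)), cont_Icc_id).
    assert (Cx : forall f, cont_Icc 0 h f -> cont_Icc 0 h (fun x => x * f x ^ 2))
      by (intros; apply cont_Icc_mult; [apply cont_Icc_id | apply cont_Icc_pow; auto]).
    assert (HJ : 0 <= J).
    { apply RInt_cont_nonneg; [lra | apply Cx, Cp|].
      intros x Hx; apply Rmult_le_pos; [lra | apply pow2_ge_0]. }
    assert (Ed : forall x, psum d n x = p x - 2 ^ n * p (x / 2)).
    { intros x; unfold p, psum; cbn [bsum].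
      unfold Rdiv; rewrite Rpow_mult_distr.
      assert (Z : 2 ^ n * (/ 2) ^ n = 1)
        by (rewrite <- Rpow_mult_distr, Rinv_r, pow1 by lra; reflexivity).
      replace (bsum (fun i => d i * x ^ i) n) with
        (bsum (fun i => c i * x ^ i) n
         + - 2 ^ n * bsum (fun i => c i * (x * / 2) ^ i) n).
      - transitivity (bsum (fun i => c i * x ^ i) n
         + - 2 ^ n * bsum (fun i => c i * (x * / 2) ^ i) n
         + c n * x ^ n * (1 - 2 ^ n * (/ 2) ^ n)); [rewrite Z; ring | ring].
      - rewrite <- bsum_scal, <- bsum_plus; apply bsum_ext; intros i _.
        rewrite Rpow_mult_distr; unfold d; ring. }
    set (Sn := psum (fun i => Rabs (c i)) n h).
    assert (HS : 0 <= Sn) by (apply psum_abs_nonneg; lra).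
    assert (HSn : h ^ 2 * Sn ^ 2 <= A * J).
    { apply Rle_trans with (h ^ 2 * psum (fun i => Rabs (d i)) n h ^ 2).
      - apply Rmult_le_compat_l; [apply pow2_ge_0|]; apply pow_incr.
        split; [exact HS|]; apply bsum_le; intros i Hi.
        apply Rmult_le_compat_r; [apply pow_le; lra|].
        unfold d; rewrite Rabs_mult; rewrite <- (Rmult_1_r (Rabs (c i))) at 1.
        apply Rmult_le_compat_l; [apply Rabs_pos|].
        (* For i < n the factor 1 - 2^(n-i) is at most -1, so passing from c to d does not shrink
           the coefficients. *)
        assert (G : 2 <= 2 ^ n * (/ 2) ^ i).
        { replace n with (i + S (n - S i))%nat by lia.
          rewrite pow_add.
          replace (2 ^ i * 2 ^ S (n - S i) * (/ 2) ^ i) with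
            (2 ^ S (n - S i) * (2 ^ i * (/ 2) ^ i)) by ring.
          rewrite <- Rpow_mult_distr, Rinv_r, pow1 by lra.
          assert (1 <= 2 ^ (n - S i)) by (apply pow_R1_Rle; lra); simpl; lra. }
        rewrite Rabs_left1; lra.
      - eapply Rle_trans; [apply IH, Hh|].
        unfold A; rewrite Rmult_assoc; apply Rmult_le_compat_l; [exact HK|].
        assert (D := RInt_half_dilation h p (Rlt_le _ _ Hh) (Cp _ _)); fold J in D.
        assert (Cd : cont_Icc 0 h (fun x => p (x / 2))).
        { apply (cont_Icc_psum 0 h c (S n) (fun x => x / 2)).
          apply cont_Icc_mult; [apply cont_Icc_id | apply cont_Icc_const]. }
        apply Rle_trans with
          (RInt (fun x => 2 * (x * p x ^ 2)
                          + 2 * (2 ^ n) ^ 2 * (x * p (x / 2) ^ 2)) 0 h).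
        + apply RInt_cont_le; [lra | apply Cx, Cp | |].
          * apply cont_Icc_plus; (apply cont_Icc_mult; [apply cont_Icc_const|]);
              apply Cx; [apply Cp | exact Cd].
          * intros x Hx; rewrite Ed.
            replace (2 * (x * p x ^ 2) + 2 * (2 ^ n) ^ 2 * (x * p (x / 2) ^ 2))
              with (x * (p x - 2 ^ n * p (x / 2)) ^ 2
                    + x * (p x + 2 ^ n * p (x / 2)) ^ 2) by ring.
            assert (0 <= x * (p x + 2 ^ n * p (x / 2)) ^ 2)
              by (apply Rmult_le_pos; [lra | apply pow2_ge_0]); lra.
        + rewrite RInt_cont_plus, !RInt_cont_scal; try lra.
          * fold J.
            apply Rle_trans with (2 * J + 2 * (2 ^ n) ^ 2 * (4 * J)); [|right; ring].
            apply Rplus_le_compat_l, Rmult_le_compat_l; [|exact D].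
            assert (0 <= (2 ^ n) ^ 2) by apply pow2_ge_0; lra.
          * apply Cx, Cd.
          * apply Cx, Cp.
          * apply cont_Icc_mult; [apply cont_Icc_const | apply Cx, Cp].
          * apply cont_Icc_mult; [apply cont_Icc_const | apply Cx, Cd]. }
    set (t := Rabs (c n) * h ^ n).
    (* The leading monomial is p minus its lower part, which is at most [Sn] on [0, h]. Integrating
       its square against the weight x gives c_n^2 h^(2n+2) / (2n+2). *)
    assert (Ht : h ^ 2 * t ^ 2 <= (2 * INR n + 2) * (2 * J + h ^ 2 * Sn ^ 2)).
    { assert (M : RInt (fun x => c n ^ 2 * x ^ (2 * n + 1)) 0 h
                  <= RInt (fun x => 2 * (x * p x ^ 2) + 2 * Sn ^ 2 * x ^ 1) 0 h).
      { apply RInt_cont_le; [lra | | |].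
        - apply cont_Icc_mult; [apply cont_Icc_const | apply cont_Icc_pow, cont_Icc_id].
        - apply cont_Icc_plus; (apply cont_Icc_mult; [apply cont_Icc_const|]);
            [apply Cx, Cp | apply cont_Icc_pow, cont_Icc_id].
        - intros x Hx.
          set (q := psum c n x).
          assert (Q : q ^ 2 <= Sn ^ 2).
          { rewrite <- (pow2_abs q); apply pow_incr; split; [apply Rabs_pos|].
            apply psum_abs_le; rewrite Rabs_pos_eq; lra. }
          assert (P : p x = q + c n * x ^ n) by reflexivity.
          replace (c n ^ 2 * x ^ (2 * n + 1)) with (x * (p x - q) ^ 2)
            by (rewrite P, pow_add, pow_mult, pow_1, <- !pow_mult, (Nat.mul_comm 2 n),
                  pow_mult; ring).
          assert (0 <= x * (p x + q) ^ 2)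
            by (apply Rmult_le_pos; [lra | apply pow2_ge_0]).
          assert (x * q ^ 2 <= x * Sn ^ 2) by (apply Rmult_le_compat_l; lra).
          replace (x * (p x - q) ^ 2)
            with (2 * (x * p x ^ 2) + 2 * (x * q ^ 2) - x * (p x + q) ^ 2) by ring.
          rewrite pow_1; lra. }
      rewrite RInt_cont_plus, !RInt_cont_scal, !RInt_pow_0 in M; try lra;
        try (apply cont_Icc_mult; [apply cont_Icc_const|]);
        try (apply Cx, Cp); try (apply cont_Icc_pow, cont_Icc_id).
      fold J in M.
      replace (INR (S (2 * n + 1))) with (2 * INR n + 2) in M
        by (rewrite S_INR, plus_INR, mult_INR; simpl; ring).
      replace (INR 2) with 2 in M by (simpl; ring).
      unfold t; rewrite Rpow_mult_distr, pow2_abs.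
      assert (G : (2 * INR n + 2) * (c n ^ 2 * (h ^ S (2 * n + 1) / (2 * INR n + 2)))
        <= (2 * INR n + 2) * (2 * J + 2 * Sn ^ 2 * (h ^ 2 / 2)))
        by (apply Rmult_le_compat_l; lra).
      replace (h ^ S (2 * n + 1)) with (h ^ 2 * (h ^ n) ^ 2) in G
        by (rewrite <- pow_mult, <- pow_add; f_equal; lia).
      replace ((2 * INR n + 2) * (c n ^ 2 * (h ^ 2 * (h ^ n) ^ 2 / (2 * INR n + 2))))
        with (h ^ 2 * (c n ^ 2 * (h ^ n) ^ 2)) in G by (field; lra).
      lra. }
    replace (psum (fun i => Rabs (c i)) (S n) h) with (Sn + t) by reflexivity.
    fold p; fold J.
    assert (h ^ 2 * (Sn + t) ^ 2 <= 2 * (h ^ 2 * Sn ^ 2) + 2 * (h ^ 2 * t ^ 2)).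
    { assert (0 <= h ^ 2 * (Sn - t) ^ 2) by (apply Rmult_le_pos; apply pow2_ge_0); lra. }
    assert ((2 * INR n + 2) * (2 * J + h ^ 2 * Sn ^ 2)
            <= (2 * INR n + 2) * (2 * J + A * J))
      by (apply Rmult_le_compat_l; lra).
    replace ((2 * A + 2 * ((2 * INR n + 2) * (2 + A))) * J)
      with (2 * (A * J) + 2 * ((2 * INR n + 2) * (2 * J + A * J))) by ring.
    lra.
Qed.

(** The weight [y - a] is the one that arises in [dg_cell_stability]. Both sides scale alike under
    dilation, so K depends on n alone. *)
Lemma poly_inverse_inequality (n : nat) :
  exists K, 0 <= K /\ forall (a b : R) (c : nat -> R), a < b ->
    (b - a) ^ 2 * psum (fun i => Rabs (c i)) n (b - a) ^ 2
    <= K * RInt (fun y => (y - a) * psum c n (y - a) ^ 2) a b.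
Proof.
  destruct (poly_inverse_inequality_0 n) as [K [HK H]].
  exists K; split; [exact HK|]; intros a b c Hab.
  specialize (H (b - a) c ltac:(lra)).
  set (F := fun x => x * psum c n x ^ 2) in *.
  assert (L := RInt_comp_lin (V := R_CompleteNormedModule) F 1 (- a) a b).
  replace (1 * a + - a) with 0 in L by ring.
  replace (1 * b + - a) with (b - a) in L by ring.
  rewrite <- L in H.
  - rewrite (RInt_cont_ext a b _ (fun y => (y - a) * psum c n (y - a) ^ 2)) in H;
      [exact H | lra|].
    intros x _; unfold F, scal; simpl; unfold mult; simpl.
    replace (1 * x + - a) with (x - a) by ring; eq_in_R; ring.
  - apply ex_RInt_cont_Icc; [lra|].
    apply cont_Icc_mult; [apply cont_Icc_id|].
    apply cont_Icc_pow, (cont_Icc_psum _ _ c n (fun x => x)), cont_Icc_id.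
Qed.

(** * Stability of the scheme on one cell, Taylor polynomials, Gronwall *)

(** In the application p is the polynomial part of the error in u, eta its Taylor remainder, f the
    error in omega, and beta the flux error at the right node; [p a] counts as data because it is
    the flux error at the left node. Testing leaves [W], the integral of [(y - a) * r y ^ 2], on one
    side and terms bounded by [h * Q] times the data on the other, where [Q] bounds r. Since
    [(h * Q) ^ 2 <= K * W], one factor [h * Q] cancels, and [h * Q] bounds |p - p(a)|. *)
Lemma dg_cell_stability (k : nat) :
  exists K, 0 < K /\
    forall (a b beta H : R) (p f eta : R -> R),
      a < b -> is_poly (S k) p -> cont_Icc a b f -> cont_Icc a b eta ->
      (forall y, Icc a b y -> Rabs (eta y) <= H) ->
      (forall psi, is_poly (S k) psi ->
         RInt (fun y => f y * psi y) a b
         = beta * psi b - p a * psi a - RInt (fun y => p y * Derive psi y) a b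
           - RInt (fun y => eta y * Derive psi y) a b) ->
      forall y, Icc a b y ->
        Rabs (p y) <= K * (Rabs beta + Rabs (p a) + H + RInt (fun y => Rabs (f y)) a b).
Proof.
  destruct (poly_inverse_inequality k) as [K [HK INV]].
  exists (1 + K); split; [lra|].
  intros a b beta H p f eta Hab Pp Cf Ceta Heta WEAK y0 Hy0.
  assert (Hab' := Rlt_le _ _ Hab).
  destruct (is_poly_quotient k a p Pp) as [r0 [Pr0 Er0]].
  destruct (is_poly_centered k a r0 Pr0) as [z Ez].
  assert (Ep : forall y, p y = p a + (y - a) * psum z k (y - a))
    by (intros; rewrite <- Ez; apply Er0).
  set (r := fun y => psum z k (y - a)).
  (* The test function is the primitive of r vanishing at a, where
     p y = p a + (y - a) r y. *)
  set (w := fun i => match i with O => 0 | S j => z j / INR (S j) end).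
  set (psi := fun y => psum w (S k) (y - a)).
  assert (Ppsi : is_poly (S k) psi)
    by (apply (is_poly_translate (S k) a (psum w (S k))), is_poly_psum).
  assert (Dpsi : forall y, Derive psi y = r y).
  { intros y; apply is_derive_unique.
    replace (r y) with (psum (fun i => INR (S i) * w (S i)) k (y - a));
      [apply is_derive_psum|].
    apply bsum_ext; intros i _; unfold w; field; apply not_0_INR; lia. }
  assert (Cr : cont_Icc a b r).
  { apply (cont_Icc_psum a b z k (fun y => y - a)).
    apply cont_Icc_minus; [apply cont_Icc_id | apply cont_Icc_const]. }
  assert (Cid : cont_Icc a b (fun y => y - a))
    by (apply cont_Icc_minus; [apply cont_Icc_id | apply cont_Icc_const]).
  assert (Cpsi := cont_Icc_is_poly a b _ psi Ppsi).
  set (h := b - a); set (Q := psum (fun i => Rabs (z i)) k h).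
  assert (HQ : 0 <= Q) by (apply psum_abs_nonneg; unfold h; lra).
  assert (Br : forall y, Icc a b y -> Rabs (r y) <= Q).
  { intros y [A B]; apply psum_abs_le; rewrite Rabs_pos_eq; unfold h; lra. }
  assert (psia : psi a = 0).
  { unfold psi; rewrite Rminus_diag, psum_shift1; unfold w; simpl; ring. }
  assert (INTr : forall x, Icc a b x -> RInt r a x = psi x).
  { intros x [A B].
    rewrite (fundamental_theorem_Icc a x psi r A).
    - rewrite psia; apply Rminus_0_r.
    - apply (cont_Icc_sub a b); auto; lra.
    - intros y _; apply has_deriv_in_is_derive; rewrite <- Dpsi.
      apply Derive_correct; eexists; apply is_derive_psum. }
  assert (Bpsi : forall x, Icc a b x -> Rabs (psi x) <= h * Q).
  { intros x Hx; rewrite <- INTr by exact Hx; destruct Hx as [A B].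
    apply Rle_trans with ((x - a) * Q).
    - apply RInt_cont_abs_le; [exact A | apply (cont_Icc_sub a b); auto; lra|].
      intros y Hy; apply Br; split; lra.
    - apply Rmult_le_compat_r; [exact HQ | unfold h; lra]. }
  set (W := RInt (fun y => (y - a) * r y ^ 2) a b).
  assert (EW : RInt (fun y => p y * Derive psi y) a b = p a * psi b + W).
  { rewrite <- (INTr b) by (split; lra); unfold W.
    rewrite <- RInt_cont_scal, <- RInt_cont_plus; auto.
    - apply RInt_cont_ext; [exact Hab'|]; intros x _.
      rewrite Dpsi, Ep; unfold r; eq_in_R; ring.
    - apply cont_Icc_mult; auto using cont_Icc_const.
    - apply cont_Icc_mult; auto using cont_Icc_pow. }
  specialize (WEAK psi Ppsi); rewrite EW, psia in WEAK.
  set (If := RInt (fun y => Rabs (f y)) a b).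
  assert (HIf : 0 <= If)
    by (apply RInt_cont_nonneg; auto using cont_Icc_abs; intros; apply Rabs_pos).
  assert (B1 : Rabs (RInt (fun y => f y * psi y) a b) <= h * Q * If).
  { eapply Rle_trans; [apply abs_RInt_le; [exact Hab'|]|].
    - apply ex_RInt_cont_Icc; auto using cont_Icc_mult.
    - unfold If; rewrite <- RInt_cont_scal; auto using cont_Icc_abs.
      apply RInt_cont_le; auto using cont_Icc_abs, cont_Icc_mult, cont_Icc_const.
      intros x Hx; rewrite Rabs_mult, Rmult_comm.
      apply Rmult_le_compat_r; [apply Rabs_pos | apply Bpsi; split; lra]. }
  assert (HH : 0 <= H) by (eapply Rle_trans; [apply Rabs_pos | apply (Heta a); split; lra]).
  assert (B2 : Rabs (RInt (fun y => eta y * Derive psi y) a b) <= h * (H * Q)).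
  { rewrite (RInt_cont_ext a b _ (fun y => eta y * r y))
      by (auto; intros; rewrite Dpsi; reflexivity).
    apply RInt_cont_abs_le; auto using cont_Icc_mult.
    intros x Hx; rewrite Rabs_mult.
    apply Rmult_le_compat; try apply Rabs_pos; [apply Heta | apply Br]; split; lra. }
  assert (B3 : Rabs ((beta - p a) * psi b) <= (Rabs beta + Rabs (p a)) * (h * Q)).
  { rewrite Rabs_mult; apply Rmult_le_compat; try apply Rabs_pos.
    - eapply Rle_trans; [apply Rabs_triang|]; rewrite Rabs_Ropp; lra.
    - apply Bpsi; split; lra. }
  set (A := Rabs beta + Rabs (p a) + H + If).
  assert (HA : 0 <= A) by (assert (X := Rabs_pos beta); assert (Y := Rabs_pos (p a)); unfold A; lra).
  assert (BW : W <= h * Q * A).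
  { assert (W = (beta - p a) * psi b - RInt (fun y => eta y * Derive psi y) a b
                - RInt (fun y => f y * psi y) a b) by lra.
    apply Rabs_le_between in B1; apply Rabs_le_between in B2.
    apply Rabs_le_between in B3; unfold A; lra. }
  assert (Hh : 0 < h) by (unfold h; lra).
  assert (BQ : h * Q <= K * A).
  { destruct (Req_dec Q 0) as [->|NQ]; [rewrite Rmult_0_r; apply Rmult_le_pos; auto|].
    assert (PQ : 0 < h * Q) by (apply Rmult_lt_0_compat; lra).
    apply Rmult_le_reg_l with (h * Q); [exact PQ|].
    assert (I := INV a b z Hab); fold h in I; fold Q in I.
    change (RInt (fun y => (y - a) * psum z k (y - a) ^ 2) a b) with W in I.
    assert (K * W <= K * (h * Q * A)) by (apply Rmult_le_compat_l; auto).
    replace (h * Q * (h * Q)) with (h ^ 2 * Q ^ 2) by ring.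
    replace (h * Q * (K * A)) with (K * (h * Q * A)) by ring; lra. }
  rewrite Ep; fold (r y0).
  eapply Rle_trans; [apply Rabs_triang|].
  assert (Rabs ((y0 - a) * r y0) <= h * Q).
  { rewrite Rabs_mult; apply Rmult_le_compat; try apply Rabs_pos; [|apply Br, Hy0].
    destruct Hy0; rewrite Rabs_pos_eq; unfold h; lra. }
  change (Rabs beta + Rabs (p a) + H + RInt (fun y => Rabs (f y)) a b) with A.
  assert (Rabs (p a) <= A) by (assert (X := Rabs_pos beta); unfold A; lra).
  lra.
Qed.

(** * Taylor remainders and uniform bounds *)

Definition taylor (F : nat -> R) (n : nat) (x : R) : R :=
  psum (fun i => F i / INR (fact i)) n x.

(** The derivative of the remainder is the remainder of the next derivative with one term fewer, and
    the remainder vanishes at a; each mean value step costs a factor [b - a]. Giving up the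
    factorial keeps this induction simple. *)
Lemma taylor_remainder (B : R) (n : nat) :
  forall (F : nat -> R -> R) (a b : R), a <= b ->
    (forall i x, (i < n)%nat -> Icc a b x -> has_deriv_in (Icc a b) (F i) x (F (S i) x)) ->
    (forall x, Icc a b x -> Rabs (F n x) <= B) ->
    forall y, Icc a b y ->
      Rabs (F 0%nat y - taylor (fun i => F i a) n (y - a)) <= B * (b - a) ^ n.
Proof.
  induction n as [|n IH]; intros F a b Hab HD HB y [Hy1 Hy2].
  - unfold taylor, psum; simpl; rewrite Rminus_0_r, Rmult_1_r.
    apply HB; split; assumption.
  - set (G := fun x => F 0%nat x - taylor (fun i => F i a) (S n) (x - a)).
    set (dG := fun x => F 1%nat x - taylor (fun i => F (S i) a) n (x - a)).
    destruct (mean_value_Icc a y G dG Hy1) as [c [Hc E]].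
    + intros x [Hx1 Hx2].
      apply (has_deriv_in_sub (Icc a b)); [intros t [? ?]; split; lra|].
      apply has_deriv_in_minus; [apply HD; [lia | split; lra]|].
      apply has_deriv_in_is_derive; unfold taylor.
      replace (psum (fun i => F (S i) a / INR (fact i)) n (x - a)) with
        (psum (fun i => INR (S i) * (F (S i) a / INR (fact (S i)))) n (x - a));
        [apply is_derive_psum|].
      apply bsum_ext; intros i _; rewrite fact_simpl, mult_INR; field.
      split; [apply INR_fact_neq_0 | apply not_0_INR; lia].
    + assert (Ga : G a = 0).
      { unfold G, taylor; rewrite Rminus_diag, psum_shift1; simpl; field. }
      assert (Hc' : Icc a b c) by (destruct Hc; split; lra).
      assert (BdG : Rabs (dG c) <= B * (b - a) ^ n).
      { apply (IH (fun i => F (S i)) a b Hab); [|exact HB | exact Hc'].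
        intros i x Hi; apply HD; lia. }
      fold (G y); replace (G y) with (dG c * (y - a)) by lra.
      rewrite Rabs_mult, (Rabs_pos_eq (y - a)) by lra.
      replace (B * (b - a) ^ S n) with (B * (b - a) ^ n * (b - a)) by (simpl; ring).
      apply Rmult_le_compat; [apply Rabs_pos | lra | exact BdG | lra].
Qed.

(** The radius chosen at (u, v) does two things: f varies by less than 1 within it, and it is at
    most 1 / (|f(u, v)| + 1). Compactness gives a common d such that near every point lies some (u,
    v) of radius at least d, whence |f| < |f(u, v)| + 1 <= 1 / d. *)
Lemma continuous_on_rectangle_bounded (a b a' b' : R) (f : R -> R -> R) :
  continuous_on (fun p : R * R => Icc a b (fst p) /\ Icc a' b' (snd p))
    (fun p : R * R => f (fst p) (snd p)) ->
  exists B, forall x y, Icc a b x -> Icc a' b' y -> Rabs (f x y) <= B.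
Proof.
  intros C.
  assert (D : forall u v, exists d : posreal, Icc a b u -> Icc a' b' v ->
    d <= / (Rabs (f u v) + 1) /\
    forall x y, Icc a b x -> Icc a' b' y -> Rabs (x - u) < d -> Rabs (y - v) < d ->
      Rabs (f x y - f u v) < 1).
  { intros u v; destruct (classic (Icc a b u /\ Icc a' b' v)) as [[Hu Hv]|N].
    - destruct (C (u, v) (conj Hu Hv) (ball (f u v) (mkposreal 1 Rlt_0_1))) as [d Hd];
        [apply locally_ball|].
      assert (P : 0 < / (Rabs (f u v) + 1))
        by (apply Rinv_0_lt_compat; assert (X := Rabs_pos (f u v)); lra).
      assert (Q : 0 < Rmin d (/ (Rabs (f u v) + 1)))
        by (apply Rmin_pos; [apply cond_pos | exact P]).
      exists (mkposreal _ Q); intros _ _; simpl; split; [apply Rmin_r|].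
      intros x y Hx Hy X Y; apply (Hd (x, y)); [|split; assumption].
      assert (L := Rmin_l d (/ (Rabs (f u v) + 1))).
      split; [change (Rabs (x - u) < d) | change (Rabs (y - v) < d)]; lra.
    - exists (mkposreal 1 Rlt_0_1); tauto. }
  set (dl := fun u v => proj1_sig (constructive_indefinite_description _ (D u v))).
  destruct (compactness_value_2d a b a' b' dl) as [d Hd].
  exists (/ d); intros x y Hx Hy; apply Rnot_lt_le; intros L.
  apply (Hd x y Hx Hy); intros (u & v & Hu & Hv & X & Y & Z).
  unfold dl in X, Y, Z; destruct constructive_indefinite_description as [e He].
  simpl in X, Y, Z; destruct (He Hu Hv) as [E1 E2].
  specialize (E2 x y Hx Hy X Y); apply Rabs_def2 in E2.
  assert (P : 0 < Rabs (f u v) + 1) by (assert (T := Rabs_pos (f u v)); lra).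
  assert (Rabs (f u v) + 1 <= / d).
  { rewrite <- (Rinv_inv (Rabs (f u v) + 1)); apply Rinv_le_contravar;
      [apply cond_pos | lra]. }
  assert (Rabs (f x y) < Rabs (f u v) + 1); [|lra].
  assert (T1 := Rle_abs (f u v)); assert (T2 := Rle_abs (- f u v)).
  rewrite Rabs_Ropp in T2; apply Rabs_def1; lra.
Qed.

(** [in_Vh] says nothing about a function outside its cell, whereas [Derive] and the test functions
    call for polynomials on the whole line; this predicate supplies such a representative. *)
Definition poly_on (n : nat) (a b : R) (f : R -> R) : Prop :=
  exists p, is_poly n p /\ forall y, Icc a b y -> f y = p y.

Lemma cont_Icc_poly_on (n : nat) (a b : R) (f : R -> R) :
  poly_on n a b f -> cont_Icc a b f.
Proof.
  intros [p [P E]]; apply (cont_Icc_ext _ _ p); [intros; symmetry; auto|].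
  apply (cont_Icc_is_poly a b n), P.
Qed.

(** Equidistant nodes inside the cell, because differentiability in time is known only at points of
    the cell. *)
Lemma poly_on_interpolation (n : nat) (a b : R) :
  a < b -> exists (p : nat -> R) (l : nat -> R -> R),
    (forall m, (m < n)%nat -> Icc a b (p m)) /\
    (forall m, (m < n)%nat -> is_poly n (l m)) /\
    forall f, poly_on n a b f ->
      forall y, Icc a b y -> f y = bsum (fun m => f (p m) * l m y) n.
Proof.
  intros Hab; set (p := fun m => a + (b - a) * (INR m / INR n)).
  destruct (is_poly_interpolation n p) as [l [Hl Hf]].
  { intros i j Hi Hj E; unfold p in E.
    assert (0 < INR n) by (apply lt_0_INR; lia).
    assert (F : INR i / INR n = INR j / INR n)
      by (apply Rmult_eq_reg_l with (b - a); lra).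
    apply INR_eq; apply Rmult_eq_reg_r with (/ INR n); [exact F|].
    apply Rinv_neq_0_compat; lra. }
  assert (Hp : forall m, (m < n)%nat -> Icc a b (p m)).
  { intros m Hm; assert (0 < INR n) by (apply lt_0_INR; lia).
    assert (0 <= INR m / INR n) by (apply Rdiv_le_0_compat; [apply pos_INR | lra]).
    assert (INR m / INR n <= 1).
    { apply Rmult_le_reg_r with (INR n); [lra|].
      replace (INR m / INR n * INR n) with (INR m) by (field; lra).
      rewrite Rmult_1_l; apply le_INR; lia. }
    assert (0 <= (b - a) * (INR m / INR n)) by (apply Rmult_le_pos; lra).
    assert ((b - a) * (INR m / INR n) <= (b - a) * 1) by (apply Rmult_le_compat_l; lra).
    split; unfold p; lra. }
  exists p, l; repeat split; try apply Hp; auto.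
  intros f [q [Pq E]] y Hy; rewrite E, (Hf q Pq) by exact Hy.
  apply bsum_ext; intros m Hm; rewrite E; auto.
Qed.

(* The coefficients are fixed linear combinations of finitely many point values,
   hence pointwise differentiability in t is enough. *)
Lemma has_deriv_in_RInt_poly_square (n : nat) (a b T s : R) (f : R -> R -> R)
    (df : R -> R) :
  a < b -> 0 < T -> Icc 0 T s ->
  (forall t, Icc 0 T t -> poly_on n a b (f t)) ->
  (forall y, Icc a b y -> has_deriv_in (Icc 0 T) (fun t => f t y) s (df y)) ->
  cont_Icc a b df /\
  has_deriv_in (Icc 0 T) (fun t => RInt (fun y => f t y * f t y) a b) s
    (2 * RInt (fun y => df y * f s y) a b).
Proof.
  intros Hab HT Hs Hp Hd.
  destruct (poly_on_interpolation n a b Hab) as [p [l [Ip [Pl L]]]].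
  assert (Hab' := Rlt_le _ _ Hab).
  assert (Cl : forall m, (m < n)%nat -> cont_Icc a b (l m))
    by (intros; apply (cont_Icc_is_poly a b n); auto).
  (* By uniqueness of the derivative, [df] inherits the interpolation formula; this is the source of
     its continuity in y. *)
  assert (Edf : forall y, Icc a b y -> df y = bsum (fun m => df (p m) * l m y) n).
  { intros y Hy; apply (has_deriv_in_unique 0 T (fun t => f t y) s); auto.
    apply (has_deriv_in_ext _ (fun t => bsum (fun m => f t (p m) * l m y) n));
      [intros t Ht; symmetry; apply L; auto | exact Hs|].
    apply (has_deriv_in_bsum _ (fun m t => f t (p m) * l m y)); intros m Hm.
    replace (df (p m) * l m y) with (df (p m) * l m y + f s (p m) * 0) by ring.
    apply (has_deriv_in_mult _ (fun t => f t (p m)) (fun _ => l m y));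
      [apply Hd; auto | apply has_deriv_in_const]. }
  assert (EX : forall (g w : R -> R), cont_Icc a b w ->
    (forall y, Icc a b y -> g y = bsum (fun m => g (p m) * l m y) n) ->
    RInt (fun y => g y * w y) a b
    = bsum (fun m => g (p m) * RInt (fun y => l m y * w y) a b) n).
  { intros g w Cw Eg; rewrite <- RInt_bsum_mult; auto.
    apply RInt_cont_ext; [exact Hab'|]; intros y Hy.
    rewrite (Eg y) by (split; lra); reflexivity. }
  assert (Cdf : cont_Icc a b df).
  { apply (cont_Icc_ext _ _ (fun y => bsum (fun m => df (p m) * l m y) n)).
    - intros y Hy; symmetry; auto.
    - apply (cont_Icc_bsum a b (fun m y => df (p m) * l m y)); intros m Hm.
      apply cont_Icc_mult; [apply cont_Icc_const | auto]. }
  split; [exact Cdf|].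
  assert (Cf : forall t, Icc 0 T t -> cont_Icc a b (f t))
    by (intros; apply (cont_Icc_poly_on n); auto).
  (* The integral of the square is the sum of [f t (p m) * g m t]. The product rule then produces
     two sums, each equal to the integral of [df * f]. *)
  set (g := fun m t => RInt (fun y => f t y * l m y) a b).
  assert (Dg : forall m, (m < n)%nat ->
    has_deriv_in (Icc 0 T) (g m) s (RInt (fun y => df y * l m y) a b)).
  { intros m Hm; rewrite (EX df (l m)) by auto.
    apply (has_deriv_in_ext _
      (fun t => bsum (fun i => f t (p i) * RInt (fun y => l i y * l m y) a b) n));
      [intros t Ht; symmetry; apply EX; auto | exact Hs|].
    apply (has_deriv_in_bsum _
      (fun i t => f t (p i) * RInt (fun y => l i y * l m y) a b)); intros i Hi.
    set (c := RInt (fun y => l i y * l m y) a b).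
    replace (df (p i) * c) with (df (p i) * c + f s (p i) * 0) by (eq_in_R; ring).
    apply (has_deriv_in_mult _ (fun t => f t (p i)) (fun _ => c));
      [apply Hd; auto | apply has_deriv_in_const]. }
  apply (has_deriv_in_ext _ (fun t => bsum (fun m => f t (p m) * g m t) n)).
  - intros t Ht; rewrite (EX (f t) (f t)) by auto.
    apply bsum_ext; intros m _; f_equal; apply RInt_cont_ext; auto.
    intros; apply Rmult_comm.
  - exact Hs.
  - replace (2 * RInt (fun y => df y * f s y) a b) with
      (bsum (fun m => df (p m) * g m s + f s (p m) * RInt (fun y => df y * l m y) a b) n).
    + apply (has_deriv_in_bsum _ (fun m t => f t (p m) * g m t)); intros m Hm.
      apply (has_deriv_in_mult _ (fun t => f t (p m)) (g m)); [apply Hd|]; auto.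
    + rewrite bsum_plus.
      rewrite (bsum_ext (fun m => df (p m) * g m s)
        (fun m => df (p m) * RInt (fun y => l m y * f s y) a b)).
      * rewrite <- EX by auto.
        rewrite (bsum_ext _ (fun m => f s (p m) * RInt (fun y => l m y * df y) a b)).
        -- rewrite <- EX by auto.
           rewrite (RInt_cont_ext a b (fun y => f s y * df y) (fun y => df y * f s y))
             by (auto; intros; apply Rmult_comm); eq_in_R; ring.
        -- intros m _; f_equal; apply RInt_cont_ext; auto.
           intros; apply Rmult_comm.
      * intros m _; f_equal; apply RInt_cont_ext; auto.
        intros; apply Rmult_comm.
Qed.

(** The function (E + H) exp(-K t) has nonpositive derivative. The mean value theorem is used
    instead of integration because [dE] is not assumed integrable. *)
Lemma gronwall_Icc (K H T : R) (E dE : R -> R) :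
  (forall s, Icc 0 T s -> has_deriv_in (Icc 0 T) E s (dE s)) ->
  (forall s, Icc 0 T s -> dE s <= K * (E s + H)) ->
  forall s, Icc 0 T s -> E s + H <= (E 0 + H) * exp (K * s).
Proof.
  intros D B s [Hs1 Hs2].
  set (G := fun t => (E t + H) * exp (- K * t)).
  destruct (mean_value_Icc 0 s G
    (fun t => (dE t + 0) * exp (- K * t) + (E t + H) * (- K * exp (- K * t))) Hs1)
    as [c [[Hc1 Hc2] M]].
  - intros t [Ht1 Ht2]; apply (has_deriv_in_sub (Icc 0 T)); [intros x [? ?]; split; lra|].
    apply (has_deriv_in_mult _ (fun t => E t + H) (fun t => exp (- K * t))).
    + apply (has_deriv_in_plus _ E (fun _ => H)); [apply D; split; lra|].
      apply has_deriv_in_const.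
    + apply has_deriv_in_is_derive; auto_derive; [exact I | ring].
  - assert (P := exp_pos (- K * c)).
    assert (N : dE c - K * (E c + H) <= 0)
      by (assert (X := B c ltac:(split; lra)); lra).
    assert ((dE c + 0) * exp (- K * c) + (E c + H) * (- K * exp (- K * c)) <= 0).
    { replace ((dE c + 0) * exp (- K * c) + (E c + H) * (- K * exp (- K * c)))
        with (- ((K * (E c + H) - dE c) * exp (- K * c))) by ring.
      assert (0 <= (K * (E c + H) - dE c) * exp (- K * c))
        by (apply Rmult_le_pos; lra); lra. }
    assert (Q : ((dE c + 0) * exp (- K * c) + (E c + H) * (- K * exp (- K * c))) * (s - 0) <= 0 * (s - 0))
      by (apply Rmult_le_compat_r; lra).
    assert (G0 : G 0 = E 0 + H) by (unfold G; rewrite Rmult_0_r, exp_0; ring).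
    assert (GL : G s <= E 0 + H) by lra.
    replace (E s + H) with (G s * exp (K * s)).
    + apply Rmult_le_compat_r; [apply Rlt_le, exp_pos | exact GL].
    + unfold G; rewrite Rmult_assoc, <- exp_plus.
      replace (- K * s + K * s) with 0 by ring; rewrite exp_0; ring.
Qed.

(** * The scheme at a fixed time *)

Lemma node_lt {yL yR : R} (M : mesh yL yR) (i : nat) :
  (i < ncells M)%nat -> node M i < node M (S i).
Proof.
  intros Hi; assert (H := node_incr _ _ M (S i) ltac:(lia)).
  simpl in H; rewrite Nat.sub_0_r in H; exact H.
Qed.

Lemma node_le {yL yR : R} (M : mesh yL yR) (i j : nat) :
  (i <= j <= ncells M)%nat -> node M i <= node M j.
Proof.
  intros [H K]; induction H as [|j H IH]; [lra|].
  assert (X := node_lt M j ltac:(lia)).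
  assert (Y := IH ltac:(lia)); lra.
Qed.

Lemma cell_incl {yL yR : R} (M : mesh yL yR) (i : nat) (y : R) :
  (i < ncells M)%nat -> Icc (node M i) (node M (S i)) y -> Icc yL yR y.
Proof.
  intros Hi [H K].
  assert (A := node_le M 0 i ltac:(lia)); rewrite node_first in A.
  assert (B := node_le M (S i) (ncells M) ltac:(lia)); rewrite node_last in B.
  split; lra.
Qed.

Lemma cell_interior {yL yR : R} (M : mesh yL yR) (i : nat) (y : R) :
  (i < ncells M)%nat -> node M i < y < node M (S i) -> yL < y < yR.
Proof.
  intros Hi [H K].
  assert (A := node_le M 0 i ltac:(lia)); rewrite node_first in A.
  assert (B := node_le M (S i) (ncells M) ltac:(lia)); rewrite node_last in B; lra.
Qed.

Lemma cell_size_sum {yL yR : R} (M : mesh yL yR) :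
  bsum (fun i => node M (S i) - node M i) (ncells M) = yR - yL.
Proof. rewrite bsum_telescope, node_first, node_last; reflexivity. Qed.

Lemma cell_size_le_hmax {yL yR : R} (M : mesh yL yR) (i : nat) :
  (i < ncells M)%nat -> node M (S i) - node M i <= hmax M.
Proof.
  intros Hi; apply MaxRlist_P1; unfold cell_sizes; apply in_map_iff.
  exists (S i); simpl; rewrite Nat.sub_0_r; split; [reflexivity|].
  apply in_seq; lia.
Qed.

Lemma hmax_bounds {yL yR : R} (M : mesh yL yR) : 0 < hmax M <= yR - yL.
Proof.
  assert (P := ncells_pos _ _ M); split.
  - assert (A := cell_size_le_hmax M 0 ltac:(lia)).
    assert (B := node_lt M 0 ltac:(lia)); lra.
  - assert (X : In (hmax M) (cell_sizes M)).
    { apply MaxRlist_P2; exists (node M 1 - node M (1 - 1)).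
      apply (in_map (fun j => node M j - node M (j - 1)) _ 1%nat), in_seq; lia. }
    apply in_map_iff in X; destruct X as [j [E Hj]]; apply in_seq in Hj.
    destruct j as [|i]; [lia|]; simpl in E; rewrite Nat.sub_0_r in E.
    rewrite <- E, <- (cell_size_sum M).
    apply (bsum_term_le (fun i => node M (S i) - node M i)); [lia|].
    intros m Hm; assert (Y := node_lt M m Hm); lra.
Qed.

Lemma cell_inner_S {yL yR : R} (M : mesh yL yR) (i : nat) (f g : R -> R) :
  cell_inner M (S i) f g = RInt (fun y => f y * g y) (node M i) (node M (S i)).
Proof. unfold cell_inner; simpl; rewrite Nat.sub_0_r; reflexivity. Qed.

Definition cell_cont {yL yR : R} (M : mesh yL yR) (v : broken) : Prop :=
  forall i, (i < ncells M)%nat -> cont_Icc (node M i) (node M (S i)) (v (S i)).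

Lemma L2norm_nonneg {yL yR : R} (M : mesh yL yR) (v : broken) : 0 <= L2norm M v.
Proof. apply sqrt_pos. Qed.

Lemma L2norm_sqr {yL yR : R} (M : mesh yL yR) (v : broken) :
  cell_cont M v ->
  L2norm M v ^ 2
  = bsum (fun i => RInt (fun y => v (S i) y * v (S i) y) (node M i) (node M (S i)))
      (ncells M).
Proof.
  intros C; unfold L2norm; rewrite sum_n_m_bsum, pow2_sqrt.
  - apply bsum_ext; intros; apply cell_inner_S.
  - apply bsum_nonneg; intros i Hi; rewrite cell_inner_S.
    assert (X := node_lt M i Hi); apply RInt_cont_nonneg; [lra | |].
    + apply cont_Icc_mult; apply C, Hi.
    + intros y _; apply Rle_0_sqr.
Qed.

(** Lets the exact solution be exchanged for the zeroth members of its derivative families, which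
    agree with it only on the closed interval. *)
Lemma L2norm_error_ext {yL yR : R} (M : mesh yL yR) (f g : R -> R) (v : broken) :
  (forall y, Icc yL yR y -> f y = g y) ->
  L2norm M (error f v) = L2norm M (error g v).
Proof.
  intros E; unfold L2norm; rewrite !sum_n_m_bsum; f_equal.
  apply bsum_ext; intros i Hi; rewrite !cell_inner_S.
  assert (X := node_lt M i Hi).
  apply RInt_cont_ext; [lra|]; intros y Hy; unfold error.
  rewrite E; [reflexivity|]; apply (cell_incl M i); [exact Hi | split; lra].
Qed.

Lemma L2norm_le_sup {yL yR : R} (M : mesh yL yR) (v : broken) (B : R) :
  cell_cont M v -> 0 <= B ->
  (forall i y, (i < ncells M)%nat -> Icc (node M i) (node M (S i)) y ->
     Rabs (v (S i) y) <= B) ->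
  L2norm M v <= sqrt (yR - yL) * B.
Proof.
  intros C HB H; rewrite <- (sqrt_pow2 (L2norm M v)) by apply L2norm_nonneg.
  rewrite <- (sqrt_pow2 B) by exact HB.
  assert (P := hmax_bounds M); rewrite <- sqrt_mult_alt by lra.
  apply sqrt_le_1_alt; rewrite L2norm_sqr, <- (cell_size_sum M) by exact C.
  rewrite Rmult_comm, <- bsum_scal; apply bsum_le; intros i Hi.
  assert (X := node_lt M i Hi).
  rewrite Rmult_comm, <- RInt_const_R; apply RInt_cont_le; [lra | | |].
  - apply cont_Icc_mult; apply C, Hi.
  - apply cont_Icc_const.
  - intros y Hy; assert (Z := H i y Hi ltac:(split; lra)).
    rewrite <- (pow2_abs B), (Rabs_pos_eq B) by exact HB.
    replace (v (S i) y * v (S i) y) with (Rabs (v (S i) y) ^ 2)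
      by (rewrite pow2_abs; ring).
    apply pow_incr; split; [apply Rabs_pos | exact Z].
Qed.

(** Cauchy-Schwarz is applied on each cell and then over the cells, with the square roots of the
    cell sizes as weights; the squares of these add up to the length of the interval. *)
Lemma L1_le_L2norm {yL yR : R} (M : mesh yL yR) (v : broken) :
  cell_cont M v ->
  bsum (fun i => RInt (fun y => Rabs (v (S i) y)) (node M i) (node M (S i))) (ncells M)
  <= sqrt (yR - yL) * L2norm M v.
Proof.
  intros C.
  set (q := fun i => RInt (fun y => v (S i) y * v (S i) y) (node M i) (node M (S i))).
  set (f := fun i => sqrt (node M (S i) - node M i)).
  set (g := fun i => sqrt (q i)).
  assert (Hq : forall i, (i < ncells M)%nat -> 0 <= q i).
  { intros i Hi; assert (X := node_lt M i Hi); apply RInt_cont_nonneg; [lra | |].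
    + apply cont_Icc_mult; apply C, Hi.
    + intros y _; apply Rle_0_sqr. }
  apply Rle_trans with (bsum (fun i => f i * g i) (ncells M)).
  - apply bsum_le; intros i Hi; apply RInt_cauchy_schwarz; [|apply C, Hi].
    assert (X := node_lt M i Hi); lra.
  - rewrite <- (sqrt_pow2 (bsum (fun i => f i * g i) (ncells M))),
      <- (sqrt_pow2 (L2norm M v)).
    + assert (P := hmax_bounds M); rewrite <- sqrt_mult_alt by lra.
      apply sqrt_le_1_alt; eapply Rle_trans; [apply bsum_cauchy_schwarz|]; right.
      rewrite L2norm_sqr by exact C; f_equal.
      * rewrite <- (cell_size_sum M); apply bsum_ext; intros i Hi.
        assert (X := node_lt M i Hi); apply pow2_sqrt; lra.
      * apply bsum_ext; intros i Hi; apply pow2_sqrt, Hq, Hi.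
    + apply L2norm_nonneg.
    + apply bsum_nonneg; intros; apply Rmult_le_pos; apply sqrt_pos.
Qed.

(** The scheme is tested cell by cell, so one polynomial repeated on all cells is as good as one
    supported on a single cell. *)
Lemma in_Vh_poly {yL yR : R} (M : mesh yL yR) (k : nat) (p : R -> R) :
  is_poly (S k) p -> in_Vh M k (fun _ => p).
Proof.
  intros [c H] j _; exists c; intros y _; rewrite H, sum_n_bsum; reflexivity.
Qed.

Lemma poly_on_in_Vh {yL yR : R} (M : mesh yL yR) (k i : nat) (v : broken) :
  in_Vh M k v -> (i < ncells M)%nat ->
  poly_on (S k) (node M i) (node M (S i)) (v (S i)).
Proof.
  intros H Hi; destruct (H (S i)) as [c Hc]; [split; lia|].
  exists (psum c (S k)); split; [apply is_poly_psum|]; intros y Hy.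
  rewrite Hc, sum_n_bsum; [reflexivity|].
  unfold cell; simpl; rewrite Nat.sub_0_r; exact Hy.
Qed.

Lemma cell_cont_in_Vh {yL yR : R} (M : mesh yL yR) (k : nat) (v : broken) :
  in_Vh M k v -> cell_cont M v.
Proof.
  intros H i Hi; apply (cont_Icc_poly_on (S k)), poly_on_in_Vh; assumption.
Qed.

Lemma cell_cont_error {yL yR : R} (M : mesh yL yR) (f : R -> R) (v : broken) :
  cont_Icc yL yR f -> cell_cont M v -> cell_cont M (error f v).
Proof.
  intros F C i Hi; apply (cont_Icc_minus _ _ f (v (S i))); [|apply C, Hi].
  apply (cont_Icc_sub yL yR); [| |exact F].
  - apply (cell_incl M i (node M i) Hi); assert (X := node_lt M i Hi); split; lra.
  - apply (cell_incl M i (node M (S i)) Hi); assert (X := node_lt M i Hi); split; lra.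
Qed.

(** The Dirichlet datum fixes the error at the last node, so increments are summed from the right.
    The induction carries the sharper bound by the sum over the cells to the right of node i. *)
Lemma backward_increment_bound (e d : nat -> R) (N : nat) :
  e N = 0 -> (forall i, (i < N)%nat -> Rabs (e (S i) - e i) <= d i) ->
  forall i, (i <= N)%nat -> Rabs (e i) <= bsum d N.
Proof.
  intros E D.
  assert (G : forall m i, (i + m = N)%nat -> Rabs (e i) <= bsum d N - bsum d i).
  { induction m as [|m IH]; intros i Hi.
    - replace i with N by lia; rewrite E, Rabs_R0; lra.
    - assert (A := IH (S i) ltac:(lia)); assert (B := D i ltac:(lia)).
      simpl in A; rewrite <- (Rabs_Ropp (e (S i) - e i)) in B.
      replace (e i) with (e (S i) + - (e (S i) - e i)) by ring.
      eapply Rle_trans; [apply Rabs_triang | lra]. }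
  intros i Hi; assert (A := G (N - i)%nat i ltac:(lia)).
  assert (0 <= bsum d i); [|lra].
  apply bsum_nonneg; intros m Hm.
  eapply Rle_trans; [apply Rabs_pos | apply D; lia].
Qed.

(** * Consistency of the constraint and the sup bound for the error in u *)

Lemma is_poly_derive (n : nat) (p : R -> R) :
  is_poly n p -> exists r, is_poly n r /\ forall y, is_derive p y (r y).
Proof.
  intros [c Hc]; destruct n as [|n].
  - exists (fun _ => 0); split; [exists c; reflexivity|].
    intros y; apply (is_derive_ext (fun _ => 0));
      [intros; rewrite Hc; reflexivity | auto_derive; auto].
  - exists (psum (fun i => INR (S i) * c (S i)) n); split;
      [apply is_poly_S, is_poly_psum|].
    intros y; rewrite <- (Rminus_0_r y) at 2.
    apply (is_derive_ext (fun x => psum c (S n) (x - 0)));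
      [intros t; rewrite Hc, Rminus_0_r; reflexivity | apply is_derive_psum].
Qed.

(** Consistency: the exact u satisfies the discrete constraint with its own nodal values as
    fluxes. *)
Lemma integration_by_parts_test (a b : R) (U dU psi : R -> R) (n : nat) :
  a <= b -> is_poly n psi -> cont_Icc a b dU ->
  (forall x, Icc a b x -> has_deriv_in (Icc a b) U x (dU x)) ->
  RInt (fun y => dU y * psi y) a b
  = U b * psi b - U a * psi a - RInt (fun y => U y * Derive psi y) a b.
Proof.
  intros Hab P CdU DU.
  destruct (is_poly_derive n psi P) as [r [Pr Dr]].
  assert (Cpsi := cont_Icc_is_poly a b n psi P).
  assert (CU := cont_Icc_of_has_deriv_in a b U dU Hab DU).
  assert (Cr := cont_Icc_is_poly a b n r Pr).
  rewrite (RInt_cont_ext a b (fun y => U y * Derive psi y) (fun y => U y * r y))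
    by (auto; intros; f_equal; apply is_derive_unique, Dr).
  assert (F := fundamental_theorem_Icc a b (fun y => U y * psi y)
                 (fun y => dU y * psi y + U y * r y) Hab).
  rewrite RInt_cont_plus in F; auto using cont_Icc_mult.
  rewrite <- F; [lra | auto using cont_Icc_plus, cont_Icc_mult|].
  intros x Hx; apply has_deriv_in_mult; [apply DU, Hx|].
  apply has_deriv_in_is_derive, Dr.
Qed.

(* Testing with constants gives the nodal values of the error in u exactly, so
   that the consistency error enters only once and is not summed over the cells. *)
Lemma dg_u_sup_error (k : nat) :
  exists K, 0 < K /\
    forall (yL yR : R) (M : mesh yL yR) (F : nat -> R -> R) (B b : R)
      (uh omegah : broken),
      (forall i y, Icc yL yR y -> has_deriv_in (Icc yL yR) (F i) y (F (S i) y)) ->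
      (forall y, Icc yL yR y -> Rabs (F (S k) y) <= B) ->
      F 0%nat yR = b -> in_Vh M k uh -> in_Vh M k omegah ->
      (forall psi j, in_Vh M k psi -> is_cell M j ->
         cell_inner M j (omegah j) (psi j)
         = cell_bracket M j (flux M uh b) psi - cell_inner M j (uh j) (Derive (psi j))) ->
      forall i y, (i < ncells M)%nat -> Icc (node M i) (node M (S i)) y ->
        Rabs (F 0%nat y - uh (S i) y)
        <= K * (sqrt (yR - yL) * L2norm M (error (F 1%nat) omegah)
                + B * hmax M ^ (k + 1)).
Proof.
  destruct (dg_cell_stability k) as [K [HK STAB]].
  (* The factor 3 counts the two nodal errors and the L^1 norm of the error in omega on the cell,
     all at most [Z] below; the 1 covers the Taylor remainder [eta]. *)
  exists (3 * K + 1); split; [lra|].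
  intros yL yR M F B b uh omegah HF HB Fb Huh Homh EQ.
  assert (LR := hmax_bounds M).
  assert (CF : forall i, cont_Icc yL yR (F i))
    by (intros i; apply (cont_Icc_of_has_deriv_in yL yR (F i) (F (S i))); [lra | apply HF]).
  set (e := fun i => F 0%nat (node M i) - flux M uh b i).
  set (eo := error (F 1%nat) omegah).
  assert (Ceo : cell_cont M eo)
    by (apply cell_cont_error; [apply CF | apply (cell_cont_in_Vh M k), Homh]).
  assert (HDF : forall i m x, (i < ncells M)%nat -> Icc (node M i) (node M (S i)) x ->
    has_deriv_in (Icc (node M i) (node M (S i))) (F m) x (F (S m) x)).
  { intros i m x Hi Hx; apply (has_deriv_in_sub (Icc yL yR));
      [intros; apply (cell_incl M i); assumption|].
    apply HF, (cell_incl M i); assumption. }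
  assert (CFc : forall i m, (i < ncells M)%nat -> cont_Icc (node M i) (node M (S i)) (F m)).
  { intros i m Hi; assert (X := node_lt M i Hi).
    apply (cont_Icc_of_has_deriv_in _ _ (F m) (F (S m))); [lra|].
    intros; apply HDF; assumption. }
  (* The error equation, the exact identity minus the scheme. The interior error of u enters only
     against [Derive psi], hence not at all for constant psi. *)
  assert (ERR : forall i psi, (i < ncells M)%nat -> is_poly (S k) psi ->
    RInt (fun y => eo (S i) y * psi y) (node M i) (node M (S i))
    = e (S i) * psi (node M (S i)) - e i * psi (node M i)
      - (RInt (fun y => F 0%nat y * Derive psi y) (node M i) (node M (S i))
         - RInt (fun y => uh (S i) y * Derive psi y) (node M i) (node M (S i)))).
  { intros i psi Hi Ppsi; assert (X := Rlt_le _ _ (node_lt M i Hi)).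
    assert (E1 := EQ (fun _ => psi) (S i) (in_Vh_poly M k psi Ppsi) ltac:(split; lia)).
    rewrite !cell_inner_S in E1; unfold cell_bracket in E1; simpl Nat.sub in E1.
    rewrite Nat.sub_0_r in E1.
    assert (E2 := integration_by_parts_test _ _ (F 0%nat) (F 1%nat) psi (S k) X Ppsi
      (CFc i 1%nat Hi) (fun x => HDF i 0%nat x Hi)).
    assert (Cpsi := cont_Icc_is_poly (node M i) (node M (S i)) _ psi Ppsi).
    assert (Com := cell_cont_in_Vh M k omegah Homh i Hi).
    rewrite (RInt_cont_ext _ _ (fun y => eo (S i) y * psi y)
      (fun y => F 1%nat y * psi y - omegah (S i) y * psi y) X)
      by (intros; unfold eo, error; eq_in_R; ring).
    rewrite RInt_cont_minus, E1, E2; auto using cont_Icc_mult.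
    unfold e; eq_in_R; ring. }
  set (S1 := bsum (fun i => RInt (fun y => Rabs (eo (S i) y)) (node M i) (node M (S i)))
               (ncells M)).
  assert (HS1 : S1 <= sqrt (yR - yL) * L2norm M eo) by (apply L1_le_L2norm, Ceo).
  assert (He : forall i, (i <= ncells M)%nat -> Rabs (e i) <= S1).
  { apply backward_increment_bound.
    - unfold e, flux; rewrite Nat.eqb_refl, node_last, Fb; ring.
    - intros i Hi; assert (X := Rlt_le _ _ (node_lt M i Hi)).
      assert (E := ERR i (fun _ => 1) Hi (is_poly_const k 1)).
      assert (Z : forall g : R -> R,
        RInt (fun y => g y * Derive (fun _ => 1) y) (node M i) (node M (S i)) = 0).
      { intros g; rewrite (RInt_cont_ext _ _ _ (fun _ => 0) X)
          by (intros; rewrite Derive_const; apply Rmult_0_r).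
        rewrite RInt_const_R; apply Rmult_0_r. }
      rewrite !Z in E.
      replace (e (S i) - e i) with
        (RInt (fun y => eo (S i) y * 1) (node M i) (node M (S i))) by lra.
      rewrite (RInt_cont_ext _ _ _ (eo (S i)) X) by (intros; apply Rmult_1_r).
      apply abs_RInt_le; [exact X | apply ex_RInt_cont_Icc; [exact X | apply Ceo, Hi]]. }
  intros i y Hi Hy.
  assert (X := node_lt M i Hi).
  destruct (poly_on_in_Vh M k i uh Huh Hi) as [p [Pp Ep]].
  set (a := node M i) in *; set (c := node M (S i)) in *.
  set (W := fun y => taylor (fun m => F m a) (S k) (y - a)).
  assert (PW : is_poly (S k) W)
    by (apply (is_poly_translate (S k) a (taylor (fun m => F m a) (S k))), is_poly_psum).
  assert (Wa : W a = F 0%nat a)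
    by (unfold W, taylor; rewrite Rminus_diag, psum_shift1; simpl; field).
  set (eta := fun y => F 0%nat y - W y).
  set (xi := fun y => W y + -1 * p y).
  assert (Pxi : is_poly (S k) xi) by (apply is_poly_plus; [|apply is_poly_scal]; assumption).
  assert (Ceta : cont_Icc a c eta)
    by (apply cont_Icc_minus; [apply CFc, Hi | apply (cont_Icc_is_poly a c (S k)), PW]).
  assert (HB0 : 0 <= B).
  { eapply Rle_trans; [apply Rabs_pos|]; apply (HB a), (cell_incl M i); [exact Hi|].
    split; unfold a, c in *; lra. }
  assert (HH : B * (c - a) ^ S k <= B * hmax M ^ (k + 1)).
  { replace (k + 1)%nat with (S k) by lia; apply Rmult_le_compat_l; [exact HB0|].
    apply pow_incr; split; [lra | apply cell_size_le_hmax, Hi]. }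
  assert (Beta : forall y, Icc a c y -> Rabs (eta y) <= B * hmax M ^ (k + 1)).
  { intros z Hz; eapply Rle_trans; [|exact HH].
    apply (taylor_remainder B (S k) F a c); [lra | | | exact Hz].
    - intros; apply HDF; assumption.
    - intros x Hx; apply HB, (cell_incl M i); assumption. }
  (* As i < N, the flux at the left node is the trace from the cell itself rather than the boundary
     datum. Together with exactness of the Taylor polynomial at a, this identifies [xi a] with
     [e i]. *)
  assert (Fi : flux M uh b i = uh (S i) a).
  { unfold flux; replace (Nat.eqb i (ncells M)) with false; [reflexivity|].
    symmetry; apply Nat.eqb_neq; lia. }
  assert (xia : xi a = e i).
  { unfold xi, e; rewrite Wa, Fi, Ep by (split; lra); fold a; ring. }
  assert (T := STAB a c (e (S i)) (B * hmax M ^ (k + 1)) xi (eo (S i)) eta X Pxi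
    (Ceo i Hi) Ceta Beta).
  assert (Bxi : Rabs (xi y) <= K * (Rabs (e (S i)) + Rabs (xi a) + B * hmax M ^ (k + 1)
     + RInt (fun y => Rabs (eo (S i) y)) a c)).
  { apply T; [|exact Hy]; intros psi Ppsi.
    assert (E := ERR i psi Hi Ppsi); fold a c in E; rewrite E, xia; clear E.
    assert (D : cont_Icc a c (Derive psi)).
    { destruct (is_poly_derive _ psi Ppsi) as [w [Pw Dw]].
      apply (cont_Icc_ext _ _ w); [|apply (cont_Icc_is_poly a c (S k)), Pw].
      intros x _; symmetry; apply is_derive_unique, Dw. }
    assert (Cxi := cont_Icc_is_poly a c _ xi Pxi).
    assert (Cu := cell_cont_in_Vh M k uh Huh i Hi).
    assert (Q : RInt (fun y => F 0%nat y * Derive psi y) a c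
                - RInt (fun y => uh (S i) y * Derive psi y) a c
                = RInt (fun y => xi y * Derive psi y) a c
                  + RInt (fun y => eta y * Derive psi y) a c).
    { rewrite <- RInt_cont_minus, <- RInt_cont_plus; auto using cont_Icc_mult; try lra.
      - apply RInt_cont_ext; [lra|]; intros x Hx; rewrite Ep by (split; lra).
        unfold xi, eta; eq_in_R; ring.
      - apply cont_Icc_mult; [apply CFc, Hi | exact D]. }
    rewrite Q; eq_in_R; ring. }
  assert (B1 := He (S i) ltac:(lia)); assert (B2 := He i ltac:(lia)).
  assert (B3 : RInt (fun y => Rabs (eo (S i) y)) a c <= S1).
  { apply (bsum_term_le (fun i => RInt (fun y => Rabs (eo (S i) y)) (node M i) (node M (S i))));
      [exact Hi|].
    intros m Hm; assert (Y := node_lt M m Hm).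
    apply RInt_cont_nonneg; [lra | apply cont_Icc_abs, Ceo, Hm | intros; apply Rabs_pos]. }
  rewrite xia in Bxi.
  assert (B4 := Beta y Hy).
  set (Z := sqrt (yR - yL) * L2norm M eo) in *; set (H := B * hmax M ^ (k + 1)) in *.
  assert (K * (Rabs (e (S i)) + Rabs (e i) + H
     + RInt (fun y => Rabs (eo (S i) y)) a c) <= K * (3 * Z + H))
    by (apply Rmult_le_compat_l; lra).
  replace (F 0%nat y - uh (S i) y) with (xi y + eta y)
    by (rewrite Ep by exact Hy; unfold xi, eta; ring).
  assert (0 <= Z) by (apply Rmult_le_pos; [apply sqrt_pos | apply L2norm_nonneg]).
  assert (0 <= H) by (eapply Rle_trans; [apply Rabs_pos | exact B4]).
  assert (0 <= K * H) by (apply Rmult_le_pos; lra).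
  replace ((3 * K + 1) * (Z + H)) with (K * (3 * Z + H) + 2 * (K * H) + Z + H) by ring.
  eapply Rle_trans; [apply Rabs_triang | lra].
Qed.

(* The products [u_h xi_o xi_r] of the two equations cancel, and the remaining
   occurrences of [u_h] are multiplied by O - Qo or R - Qr, so that no a priori
   bound on [u_h] is needed. *)
Lemma energy_cell_estimate (a b B D dl ep : R)
    (U O Rh uh oh rh Qo Qr dQo dQr doh drh : R -> R) :
  a <= b -> 0 <= dl -> dl <= D -> 0 <= ep ->
  (forall f, In f [U; O; Rh; uh; oh; rh; Qo; Qr; dQo; dQr; doh; drh] -> cont_Icc a b f) ->
  (forall y, a < y < b -> Rabs (U y) <= B /\ Rabs (O y) <= B /\ Rabs (Rh y) <= B) ->
  (forall y, a < y < b -> Rabs (O y - Qo y) <= dl /\ Rabs (Rh y - Qr y) <= dl /\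
     Rabs (Rh y * U y - dQo y) <= dl /\ Rabs (- (U y * O y) - dQr y) <= dl) ->
  (forall y, a < y < b -> Rabs (U y - uh y) <= ep) ->
  RInt (fun y => doh y * (Qo y - oh y)) a b
  = RInt (fun y => rh y * uh y * (Qo y - oh y)) a b ->
  RInt (fun y => drh y * (Qr y - rh y)) a b
  = - RInt (fun y => uh y * oh y * (Qr y - rh y)) a b ->
  RInt (fun y => (dQo y - doh y) * (Qo y - oh y)) a b
  + RInt (fun y => (dQr y - drh y) * (Qr y - rh y)) a b
  <= (1 + 2 * B + D) *
     ((b - a) * (ep + dl) ^ 2
      + (RInt (fun y => (Qo y - oh y) * (Qo y - oh y)) a b
         + RInt (fun y => (Qr y - rh y) * (Qr y - rh y)) a b)).
Proof.
  intros Hab Hdl HD Hep C HB Hd He Wo Wr.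
  assert (CU : cont_Icc a b U) by (apply C; simpl; tauto).
  assert (CO : cont_Icc a b O) by (apply C; simpl; tauto).
  assert (CR : cont_Icc a b Rh) by (apply C; simpl; tauto).
  assert (Cu : cont_Icc a b uh) by (apply C; simpl; tauto).
  assert (Co : cont_Icc a b oh) by (apply C; simpl; tauto).
  assert (Cr : cont_Icc a b rh) by (apply C; simpl; tauto).
  assert (CQo : cont_Icc a b Qo) by (apply C; simpl; tauto).
  assert (CQr : cont_Icc a b Qr) by (apply C; simpl; tauto).
  assert (CdQo : cont_Icc a b dQo) by (apply C; simpl; tauto).
  assert (CdQr : cont_Icc a b dQr) by (apply C; simpl; tauto).
  assert (Cdo : cont_Icc a b doh) by (apply C; simpl; tauto).
  assert (Cdr : cont_Icc a b drh) by (apply C; simpl; tauto).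
  clear C.
  set (xo := fun y => Qo y - oh y); set (xr := fun y => Qr y - rh y).
  assert (Cxo : cont_Icc a b xo) by (apply cont_Icc_minus; auto).
  assert (Cxr : cont_Icc a b xr) by (apply cont_Icc_minus; auto).
  change (RInt (fun y => doh y * xo y) a b = RInt (fun y => rh y * uh y * xo y) a b) in Wo.
  change (RInt (fun y => drh y * xr y) a b = - RInt (fun y => uh y * oh y * xr y) a b) in Wr.
  change (RInt (fun y => (dQo y - doh y) * xo y) a b
          + RInt (fun y => (dQr y - drh y) * xr y) a b
          <= (1 + 2 * B + D) * ((b - a) * (ep + dl) ^ 2
             + (RInt (fun y => xo y * xo y) a b + RInt (fun y => xr y * xr y) a b))).
  (* The tested evolution equations replace the discrete time derivatives by the nonlinear terms. *)
  assert (E : RInt (fun y => (dQo y - doh y) * xo y) a b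
              + RInt (fun y => (dQr y - drh y) * xr y) a b
              = RInt (fun y => (dQo y - rh y * uh y) * xo y + (dQr y + uh y * oh y) * xr y) a b).
  { rewrite (RInt_cont_ext a b (fun y => (dQo y - doh y) * xo y)
      (fun y => dQo y * xo y - doh y * xo y) Hab) by (intros; eq_in_R; ring).
    rewrite (RInt_cont_ext a b (fun y => (dQr y - drh y) * xr y)
      (fun y => dQr y * xr y - drh y * xr y) Hab) by (intros; eq_in_R; ring).
    rewrite (RInt_cont_ext a b
      (fun y => (dQo y - rh y * uh y) * xo y + (dQr y + uh y * oh y) * xr y)
      (fun y => (dQo y * xo y - rh y * uh y * xo y) + (dQr y * xr y + uh y * oh y * xr y)) Hab)
      by (intros; eq_in_R; ring).
    rewrite RInt_cont_plus, !RInt_cont_minus, RInt_cont_plus, Wo, Wr;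
      auto 6 using cont_Icc_mult, cont_Icc_plus, cont_Icc_minus; eq_in_R; ring. }
  rewrite E, <- RInt_const_R, <- !RInt_cont_plus, <- RInt_cont_scal;
    auto 6 using cont_Icc_mult, cont_Icc_plus, cont_Icc_const.
  apply RInt_cont_le; auto 8 using cont_Icc_mult, cont_Icc_plus, cont_Icc_minus, cont_Icc_const.
  intros y Hy; specialize (HB y Hy); specialize (Hd y Hy); specialize (He y Hy).
  destruct HB as [HU [HO HR]]; destruct Hd as [D1 [D2 [D3 D4]]].
  assert (HB0 : 0 <= B) by (eapply Rle_trans; [apply Rabs_pos | exact HU]).
  set (s := ep + dl); set (m := 1 + 2 * B + D).
  assert (Hs : 0 <= s) by (unfold s; lra).
  (* One estimate for both residuals: x is the Taylor remainder of a time derivative, [f * q] an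
     exact factor times the error in u, and [w * n] is u_h times a Taylor remainder. Splitting u_h
     as U - (U - u_h) leaves a product of two errors, which is linear in ep thanks to [dl <= D]. *)
  assert (G : forall x f q n w, Rabs x <= dl -> Rabs f <= B -> Rabs n <= dl ->
     Rabs (U y - uh y) <= ep -> w = uh y -> Rabs (q) <= ep ->
     Rabs (x + (f * q + w * n)) <= m * s).
  { intros x f q n w Hx Hf Hn Hu -> Hq.
    replace (uh y) with (U y - (U y - uh y)) by ring.
    assert (A1 : Rabs (f * q) <= B * ep)
      by (rewrite Rabs_mult; apply Rmult_le_compat; auto using Rabs_pos).
    assert (A2 : Rabs (U y * n) <= B * dl)
      by (rewrite Rabs_mult; apply Rmult_le_compat; auto using Rabs_pos).
    assert (A3 : Rabs ((U y - uh y) * n) <= ep * D)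
      by (rewrite Rabs_mult; apply Rmult_le_compat; auto using Rabs_pos; lra).
    assert (Rabs (x + (f * q + (U y - (U y - uh y)) * n)) <= dl + B * ep + B * dl + ep * D).
    { apply Rabs_le_between in Hx; apply Rabs_le_between in A1.
      apply Rabs_le_between in A2; apply Rabs_le_between in A3.
      apply Rabs_le_between; lra. }
    assert (0 <= B * ep) by (apply Rmult_le_pos; lra).
    assert (0 <= B * dl) by (apply Rmult_le_pos; lra).
    assert (0 <= D * dl) by (apply Rmult_le_pos; lra).
    unfold m, s; lra. }
  assert (GX := G (- (Rh y * U y - dQo y)) (Rh y) (U y - uh y) (Rh y - Qr y) (uh y)
    ltac:(rewrite Rabs_Ropp; exact D3) HR D2 He eq_refl He).
  assert (GY := G (- (U y * O y) - dQr y) (O y) (U y - uh y) (O y - Qo y) (uh y)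
    D4 HO D1 He eq_refl He).
  set (X := - (Rh y * U y - dQo y) + (Rh y * (U y - uh y) + uh y * (Rh y - Qr y))) in *.
  set (Y := - (U y * O y) - dQr y + (O y * (U y - uh y) + uh y * (O y - Qo y))) in *.
  (* Here X = dQo - uh Qr and Y = -dQr - uh Qo, so the two factors are X + uh xr and -Y - uh xo, and
     the terms uh xo xr cancel. *)
  replace ((dQo y - rh y * uh y) * xo y + (dQr y + uh y * oh y) * xr y)
    with (X * xo y - Y * xr y) by (unfold X, Y, xo, xr; ring).
  generalize (xo y) (xr y); intros p q.
  assert (HX : X * p <= m * s * Rabs p).
  { eapply Rle_trans; [apply Rle_abs|]; rewrite Rabs_mult.
    apply Rmult_le_compat_r; [apply Rabs_pos | exact GX]. }
  assert (HY : - (Y * q) <= m * s * Rabs q).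
  { eapply Rle_trans; [apply Rle_abs|]; rewrite Rabs_Ropp, Rabs_mult.
    apply Rmult_le_compat_r; [apply Rabs_pos | exact GY]. }
  assert (Sp : p * p = Rabs p * Rabs p)
    by (rewrite <- Rabs_mult; symmetry; apply Rabs_pos_eq, Rle_0_sqr).
  assert (Sq : q * q = Rabs q * Rabs q)
    by (rewrite <- Rabs_mult; symmetry; apply Rabs_pos_eq, Rle_0_sqr).
  assert (Hm : 0 <= m) by (unfold m; lra).
  apply Rle_trans with (m * (s * Rabs p + s * Rabs q)); [lra|].
  apply Rmult_le_compat_l; [exact Hm|]; rewrite Sp, Sq.
  assert (0 <= (s - Rabs p) ^ 2) by apply pow2_ge_0.
  assert (0 <= (s - Rabs q) ^ 2) by apply pow2_ge_0.
  assert (0 <= Rabs p ^ 2) by apply pow2_ge_0.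
  assert (0 <= Rabs q ^ 2) by apply pow2_ge_0.
  lra.
Qed.

(** * The energy estimate *)

(** The expansion point does not move with t, so only the coefficients are differentiated. *)
Lemma has_deriv_in_taylor (T s x : R) (n : nat) (F : nat -> R -> R) (dF : nat -> R) :
  (forall i, has_deriv_in (Icc 0 T) (F i) s (dF i)) ->
  has_deriv_in (Icc 0 T) (fun t => taylor (fun i => F i t) n x) s (taylor dF n x).
Proof.
  intros H; apply (has_deriv_in_bsum _ (fun i t => F i t / INR (fact i) * x ^ i)).
  intros i _.
  replace (dF i / INR (fact i) * x ^ i) with (x ^ i / INR (fact i) * dF i)
    by (field; apply INR_fact_neq_0).
  intros eps He.
  destruct (has_deriv_in_scal _ (x ^ i / INR (fact i)) _ _ _ (H i) eps He) as [d [Hd K]].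
  exists d; split; [exact Hd|]; intros t Ht.
  replace (F i t / INR (fact i) * x ^ i - F i s / INR (fact i) * x ^ i)
    with (x ^ i / INR (fact i) * F i t - x ^ i / INR (fact i) * F i s)
    by (field; apply INR_fact_neq_0).
  apply K, Ht.
Qed.

Lemma is_poly_taylor (F : nat -> R) (n : nat) (a : R) :
  is_poly n (fun y => taylor F n (y - a)).
Proof. apply (is_poly_translate n a (taylor F n)), is_poly_psum. Qed.

(** From f^2 <= 2 g^2 + 2 (f - g)^2, whose slack is (f - 2 g)^2. It is used in both directions
    between the full errors and their polynomial parts. *)
Lemma RInt_square_perturb (a b d : R) (f g : R -> R) :
  a <= b -> cont_Icc a b f -> cont_Icc a b g ->
  (forall y, a < y < b -> Rabs (f y - g y) <= d) ->
  RInt (fun y => f y * f y) a b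
  <= 2 * RInt (fun y => g y * g y) a b + (b - a) * (2 * d ^ 2).
Proof.
  intros Hab Cf Cg H.
  rewrite <- RInt_const_R, <- RInt_cont_scal, <- RInt_cont_plus;
    auto using cont_Icc_mult, cont_Icc_const.
  apply RInt_cont_le; auto using cont_Icc_mult, cont_Icc_plus, cont_Icc_const.
  intros y Hy; specialize (H y Hy).
  assert (Q : (f y - g y) ^ 2 <= d ^ 2)
    by (rewrite <- pow2_abs; apply pow_incr; split; [apply Rabs_pos | exact H]).
  assert (0 <= (f y - 2 * g y) ^ 2) by apply pow2_ge_0; lra.
Qed.

(** The differential part of [smooth]; joint continuity enters the proof only through the uniform
    bounds of [common_bound]. *)
Definition derivative_family (yL yR T : R) (D : nat -> nat -> R -> R -> R) : Prop :=
  forall i j y s, Icc yL yR y -> Icc 0 T s ->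
    has_deriv_in (Icc yL yR) (fun z => D i j z s) y (D (S i) j y s) /\
    has_deriv_in (Icc 0 T) (fun t => D i j y t) s (D i (S j) y s).

Lemma derivative_family_cont (yL yR T : R) (D : nat -> nat -> R -> R -> R)
    (i j : nat) (s : R) :
  yL <= yR -> derivative_family yL yR T D -> Icc 0 T s ->
  cont_Icc yL yR (fun y => D i j y s).
Proof.
  intros HL H Hs; apply (cont_Icc_of_has_deriv_in _ _ _ (fun y => D (S i) j y s));
    [exact HL|].
  intros y Hy; apply (H i j y s Hy Hs).
Qed.

(* [E] is the squared L2 distance between the numerical solution and the cellwise
   Taylor polynomials, at the left end point of each cell, of omega and rho. *)
Lemma dg_energy (k : nat) :
  exists K, 0 < K /\
    forall (yL yR T B : R) (g : R -> R) (M : mesh yL yR)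
      (Du Do Dr : nat -> nat -> R -> R -> R) (uh rhoh omegah : R -> broken),
      0 < T -> 0 <= B ->
      derivative_family yL yR T Du -> derivative_family yL yR T Do ->
      derivative_family yL yR T Dr ->
      (forall F, In F [Du 0%nat 0%nat; Do 0%nat 0%nat; Dr 0%nat 0%nat; Du (S k) 0%nat;
                       Do (S k) 0%nat; Dr (S k) 0%nat; Do (S k) 1%nat; Dr (S k) 1%nat] ->
         forall y s, Icc yL yR y -> Icc 0 T s -> Rabs (F y s) <= B) ->
      (forall y s, yL < y < yR -> Icc 0 T s ->
         Dr 0%nat 1%nat y s = - (Du 0%nat 0%nat y s * Do 0%nat 0%nat y s) /\
         Do 0%nat 1%nat y s = Dr 0%nat 0%nat y s * Du 0%nat 0%nat y s /\
         Du 1%nat 0%nat y s = Do 0%nat 0%nat y s) ->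
      (forall s, Icc 0 T s -> Du 0%nat 0%nat yR s = g s) ->
      dg_solution M k T g uh rhoh omegah ->
      let L := yR - yL in
      let dl := B * hmax M ^ (k + 1) in
      let nu s := L2norm M (error (fun y => Du 0%nat 0%nat y s) (uh s)) in
      let no s := L2norm M (error (fun y => Do 0%nat 0%nat y s) (omegah s)) in
      let nr s := L2norm M (error (fun y => Dr 0%nat 0%nat y s) (rhoh s)) in
      exists E dE : R -> R, forall s, Icc 0 T s ->
        has_deriv_in (Icc 0 T) E s (dE s) /\
        dE s <= 2 * (1 + 2 * B + B * L ^ (k + 1))
                * (L * (K * (sqrt L * no s + dl) + dl) ^ 2 + E s) /\
        0 <= E s /\
        no s ^ 2 + nr s ^ 2 <= 2 * E s + 4 * L * dl ^ 2 /\
        E s <= 2 * (no s ^ 2 + nr s ^ 2) + 4 * L * dl ^ 2 /\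
        nu s <= sqrt L * (K * (sqrt L * no s + dl)).
Proof.
  destruct (dg_u_sup_error k) as [K [HK SUP]].
  exists K; split; [exact HK|].
  intros yL yR T B g M Du Do Dr uh rhoh omegah HT HB FDu FDo FDr BD EQ BC DG L dl nu no nr.
  destruct DG as [VH [rhoh_s [omegah_s [DT [Er Eo]]]] CONS].
  assert (LR := hmax_bounds M); fold L in LR.
  assert (HL : yL <= yR) by (unfold L in LR; lra).
  assert (Hdl : 0 <= dl)
    by (apply Rmult_le_pos; [exact HB | apply pow_le; lra]).
  assert (HdlB : dl <= B * L ^ (k + 1))
    by (apply Rmult_le_compat_l; [exact HB | apply pow_incr; lra]).
  (* [Q D j i] approximates the j-th time derivative on cell [S i]; in particular [Q D 1] is the
     time derivative of [Q D 0]. *)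
  set (Q := fun (D : nat -> nat -> R -> R -> R) (j i : nat) (s y : R) =>
    taylor (fun m => D m j (node M i) s) (S k) (y - node M i)).
  assert (PQ : forall D j i s, is_poly (S k) (Q D j i s))
    by (intros; apply is_poly_taylor).
  assert (CQ : forall D j i s a b, cont_Icc a b (Q D j i s))
    by (intros; apply (cont_Icc_is_poly _ _ (S k)); auto).
  assert (BQ : forall D j i s y, derivative_family yL yR T D -> Icc 0 T s ->
    (i < ncells M)%nat -> Icc (node M i) (node M (S i)) y ->
    (forall y, Icc yL yR y -> Rabs (D (S k) j y s) <= B) ->
    Rabs (D 0%nat j y s - Q D j i s y) <= dl).
  { intros D j i s y FD Hs Hi Hy BDk; assert (X := node_lt M i Hi).
    apply Rle_trans with (B * (node M (S i) - node M i) ^ S k).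
    - apply (taylor_remainder B (S k) (fun m y => D m j y s)); [lra | | | exact Hy].
      + intros m x _ Hx; apply (has_deriv_in_sub (Icc yL yR));
          [intros; apply (cell_incl M i); assumption|].
        apply FD; [apply (cell_incl M i); assumption | exact Hs].
      + intros x Hx; apply BDk, (cell_incl M i); assumption.
    - unfold dl; replace (k + 1)%nat with (S k) by lia.
      apply Rmult_le_compat_l; [exact HB|]; apply pow_incr; split; [lra|].
      apply cell_size_le_hmax, Hi. }
  set (xo := fun i s y => Q Do 0%nat i s y - omegah s (S i) y).
  set (xr := fun i s y => Q Dr 0%nat i s y - rhoh s (S i) y).
  set (dxo := fun i s y => Q Do 1%nat i s y - omegah_s s (S i) y).
  set (dxr := fun i s y => Q Dr 1%nat i s y - rhoh_s s (S i) y).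
  assert (PX : forall D (v : R -> broken), (forall s, Icc 0 T s -> in_Vh M k (v s)) ->
    forall i s, (i < ncells M)%nat -> Icc 0 T s ->
    exists p, is_poly (S k) p /\ forall y, Icc (node M i) (node M (S i)) y ->
      Q D 0%nat i s y - v s (S i) y = p y).
  { intros D v Hv i s Hi Hs; destruct (poly_on_in_Vh M k i (v s) (Hv s Hs) Hi) as [p [Pp Ep]].
    exists (fun y => Q D 0%nat i s y + -1 * p y); split.
    - apply is_poly_plus; [apply PQ | apply is_poly_scal, Pp].
    - intros y Hy; rewrite Ep by exact Hy; ring. }
  assert (DX : forall D (v dv : R -> broken), derivative_family yL yR T D ->
    (forall s, Icc 0 T s -> in_Vh M k (v s)) ->
    (forall s j y, Icc 0 T s -> is_cell M j -> cell M j y ->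
       has_deriv_in (Icc 0 T) (fun t => v t j y) s (dv s j y)) ->
    forall i s, (i < ncells M)%nat -> Icc 0 T s ->
    cont_Icc (node M i) (node M (S i)) (dv s (S i)) /\
    has_deriv_in (Icc 0 T)
      (fun t => RInt (fun y => (Q D 0%nat i t y - v t (S i) y)
                               * (Q D 0%nat i t y - v t (S i) y)) (node M i) (node M (S i))) s
      (2 * RInt (fun y => (Q D 1%nat i s y - dv s (S i) y)
                          * (Q D 0%nat i s y - v s (S i) y)) (node M i) (node M (S i)))).
  { intros D v dv FD Hv Hd i s Hi Hs.
    assert (X := node_lt M i Hi).
    assert (Hd' : forall y, Icc (node M i) (node M (S i)) y ->
      has_deriv_in (Icc 0 T) (fun t => v t (S i) y) s (dv s (S i) y)).
    { intros y Hy; apply Hd; [exact Hs | split; lia|].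
      unfold cell; simpl; rewrite Nat.sub_0_r; exact Hy. }
    split.
    - apply (has_deriv_in_RInt_poly_square (S k) _ _ T s (fun t y => v t (S i) y)); auto.
      intros t Ht; apply poly_on_in_Vh; auto.
    - apply (has_deriv_in_RInt_poly_square (S k) _ _ T s
        (fun t y => Q D 0%nat i t y - v t (S i) y)
        (fun y => Q D 1%nat i s y - dv s (S i) y)); auto.
      + intros t Ht; apply (PX D v Hv i t Hi Ht).
      + intros y Hy; apply has_deriv_in_minus; [|apply Hd', Hy].
        apply (has_deriv_in_taylor T s _ (S k) (fun m t => D m 0%nat (node M i) t)).
        intros m; apply FD; [|exact Hs].
        apply (cell_incl M i); [exact Hi | split; lra]. }
  assert (VO : forall s, Icc 0 T s -> in_Vh M k (omegah s)) by (intros; apply VH; auto).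
  assert (VR : forall s, Icc 0 T s -> in_Vh M k (rhoh s)) by (intros; apply VH; auto).
  assert (VU : forall s, Icc 0 T s -> in_Vh M k (uh s)) by (intros; apply VH; auto).
  assert (DXo := DX Do omegah omegah_s FDo VO (fun s j y H1 H2 H3 => proj2 (DT s j y H1 H2 H3))).
  assert (DXr := DX Dr rhoh rhoh_s FDr VR (fun s j y H1 H2 H3 => proj1 (DT s j y H1 H2 H3))).
  assert (CF : forall D i j s, derivative_family yL yR T D -> Icc 0 T s -> (i < ncells M)%nat ->
    cont_Icc (node M i) (node M (S i)) (fun y => D 0%nat j y s)).
  { intros D i j s FD Hs Hi.
    assert (X := node_lt M i Hi).
    apply (cont_Icc_of_has_deriv_in _ _ _ (fun y => D 1%nat j y s)); [lra|].
    intros y Hy; apply (has_deriv_in_sub (Icc yL yR));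
      [intros; apply (cell_incl M i); assumption|].
    apply FD; [apply (cell_incl M i); assumption | exact Hs]. }
  set (I2 := fun (f : R -> R) i => RInt (fun y => f y * f y) (node M i) (node M (S i))).
  exists (fun s => bsum (fun i => I2 (xo i s) i + I2 (xr i s) i) (ncells M)).
  exists (fun s => bsum (fun i =>
    2 * RInt (fun y => dxo i s y * xo i s y) (node M i) (node M (S i))
    + 2 * RInt (fun y => dxr i s y * xr i s y) (node M i) (node M (S i))) (ncells M)).
  intros s Hs.
  assert (Cxo : forall i, (i < ncells M)%nat -> cont_Icc (node M i) (node M (S i)) (xo i s))
    by (intros i Hi; apply (cont_Icc_poly_on (S k)), (PX Do omegah VO i s Hi Hs)).
  assert (Cxr : forall i, (i < ncells M)%nat -> cont_Icc (node M i) (node M (S i)) (xr i s))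
    by (intros i Hi; apply (cont_Icc_poly_on (S k)), (PX Dr rhoh VR i s Hi Hs)).
  assert (Ceo : cell_cont M (error (fun y => Do 0%nat 0%nat y s) (omegah s)))
    by (apply cell_cont_error; [apply (derivative_family_cont yL yR T); auto
                               | apply (cell_cont_in_Vh M k); auto]).
  assert (Cer : cell_cont M (error (fun y => Dr 0%nat 0%nat y s) (rhoh s)))
    by (apply cell_cont_error; [apply (derivative_family_cont yL yR T); auto
                               | apply (cell_cont_in_Vh M k); auto]).
  assert (Ceu : cell_cont M (error (fun y => Du 0%nat 0%nat y s) (uh s)))
    by (apply cell_cont_error; [apply (derivative_family_cont yL yR T); auto
                               | apply (cell_cont_in_Vh M k); auto]).
  set (ep := K * (sqrt L * no s + dl)).
  assert (Hno : 0 <= no s) by (unfold no; apply L2norm_nonneg).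
  assert (Hep : 0 <= ep).
  { apply Rmult_le_pos; [lra|]; assert (0 <= sqrt L * no s); [|lra].
    apply Rmult_le_pos; [apply sqrt_pos | exact Hno]. }
  assert (Beu : forall i y, (i < ncells M)%nat -> Icc (node M i) (node M (S i)) y ->
    Rabs (Du 0%nat 0%nat y s - uh s (S i) y) <= ep).
  { intros i y Hi Hy.
    assert (S0 := SUP yL yR M (fun m y => Du m 0%nat y s) B (g s) (uh s) (omegah s)).
    simpl in S0; unfold ep, no.
    (* The sup bound speaks of u_y and the energy of omega. They are known to agree on the open
       interval, which is enough for integrals. *)
    replace (L2norm M (error (fun y => Do 0%nat 0%nat y s) (omegah s)))
      with (L2norm M (error (fun y => Du 1%nat 0%nat y s) (omegah s))).
    - apply S0; auto.
      + intros m z Hz; apply (FDu m 0%nat z s Hz Hs).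
      + intros z Hz; apply BD; simpl; auto.
    - unfold L2norm; rewrite !sum_n_m_bsum; f_equal; apply bsum_ext; intros m Hm.
      rewrite !cell_inner_S; assert (X := node_lt M m Hm).
      apply RInt_cont_ext; [lra|]; intros z Hz; unfold error.
      destruct (EQ z s (cell_interior M m z Hm Hz) Hs) as [_ [_ ->]]; reflexivity. }
  assert (BQo : forall i y, (i < ncells M)%nat -> Icc (node M i) (node M (S i)) y ->
    Rabs (Do 0%nat 0%nat y s - Q Do 0%nat i s y) <= dl)
    by (intros; apply BQ; auto; intros; apply BD; simpl; auto 10).
  assert (BQr : forall i y, (i < ncells M)%nat -> Icc (node M i) (node M (S i)) y ->
    Rabs (Dr 0%nat 0%nat y s - Q Dr 0%nat i s y) <= dl)
    by (intros; apply BQ; auto; intros; apply BD; simpl; auto 10).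
  assert (SL : forall c, bsum (fun i => (node M (S i) - node M i) * c) (ncells M) = L * c).
  { intros c; rewrite (bsum_ext _ (fun i => c * (node M (S i) - node M i)))
      by (intros; ring); rewrite bsum_scal, cell_size_sum; apply Rmult_comm. }
  repeat split.
  - apply (has_deriv_in_bsum _ (fun i t => I2 (xo i t) i + I2 (xr i t) i)); intros i Hi.
    apply has_deriv_in_plus; [apply (DXo i s Hi Hs) | apply (DXr i s Hi Hs)].
  - rewrite <- SL, <- bsum_plus, <- bsum_scal; apply bsum_le; intros i Hi.
    assert (X := node_lt M i Hi).
    rewrite <- Rmult_plus_distr_l, Rmult_assoc; apply Rmult_le_compat_l; [lra|].
    (* The polynomial parts of the errors are themselves admissible test functions in the two
       evolution equations. *)
    destruct (PX Do omegah VO i s Hi Hs) as [po [Ppo Epo]].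
    destruct (PX Dr rhoh VR i s Hi Hs) as [pr [Ppr Epr]].
    assert (Wo := Eo s (fun _ => po) (S i) Hs (in_Vh_poly M k po Ppo) ltac:(split; lia)).
    assert (Wr := Er s (fun _ => pr) (S i) Hs (in_Vh_poly M k pr Ppr) ltac:(split; lia)).
    rewrite !cell_inner_S in Wo, Wr.
    apply (energy_cell_estimate _ _ B (B * L ^ (k + 1)) dl ep
      (fun y => Du 0%nat 0%nat y s) (fun y => Do 0%nat 0%nat y s) (fun y => Dr 0%nat 0%nat y s)
      (uh s (S i)) (omegah s (S i)) (rhoh s (S i)) (Q Do 0%nat i s) (Q Dr 0%nat i s)
      (Q Do 1%nat i s) (Q Dr 1%nat i s) (omegah_s s (S i)) (rhoh_s s (S i)));
      auto; try lra.
    + intros f Hf; simpl in Hf.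
      repeat destruct Hf as [<-|Hf]; try contradiction; auto;
        first [apply (DXo i s Hi Hs) | apply (DXr i s Hi Hs)
              | apply (cell_cont_in_Vh M k); auto].
    + intros y Hy; assert (Iy : Icc yL yR y) by (apply (cell_incl M i); [|split]; auto; lra).
      repeat split; apply BD; simpl; auto 10.
    + intros y Hy; assert (Cy : Icc (node M i) (node M (S i)) y) by (split; lra).
      (* The differential equations turn the nonlinear terms into time derivatives, so the last two
         bounds become Taylor remainders of [Do 0 1] and [Dr 0 1]. *)
      destruct (EQ y s (cell_interior M i y Hi Hy) Hs) as [<- [<- _]].
      repeat split; auto; apply BQ; auto; intros; apply BD; simpl; auto 10.
    + intros y Hy; apply Beu; [exact Hi | split; lra].
    + rewrite (RInt_cont_ext _ _ _ (fun y => omegah_s s (S i) y * po y))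
        by (try lra; intros; rewrite Epo by (split; lra); reflexivity).
      rewrite Wo; apply RInt_cont_ext; [lra|].
      intros; rewrite Epo by (split; lra); reflexivity.
    + rewrite (RInt_cont_ext _ _ _ (fun y => rhoh_s s (S i) y * pr y))
        by (try lra; intros; rewrite Epr by (split; lra); reflexivity).
      rewrite (RInt_cont_ext _ _ (fun y => uh s (S i) y * omegah s (S i) y * _)
        (fun y => uh s (S i) y * omegah s (S i) y * pr y))
        by (try lra; intros; rewrite Epr by (split; lra); reflexivity).
      lra.
  - apply bsum_nonneg; intros i Hi; assert (X := node_lt M i Hi).
    assert (0 <= I2 (xo i s) i)
      by (apply RInt_cont_nonneg; [lra | auto using cont_Icc_mult | intros; apply Rle_0_sqr]).
    assert (0 <= I2 (xr i s) i)
      by (apply RInt_cont_nonneg; [lra | auto using cont_Icc_mult | intros; apply Rle_0_sqr]).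
    lra.
  - unfold no, nr; rewrite !L2norm_sqr by assumption.
    replace (4 * L * dl ^ 2) with (L * (4 * dl ^ 2)) by ring.
    rewrite <- SL, <- !bsum_scal, <- !bsum_plus; apply bsum_le; intros i Hi.
    assert (X := node_lt M i Hi).
    assert (P1 := RInt_square_perturb _ _ dl _ (xo i s) (Rlt_le _ _ X) (Ceo i Hi) (Cxo i Hi)).
    assert (P2 := RInt_square_perturb _ _ dl _ (xr i s) (Rlt_le _ _ X) (Cer i Hi) (Cxr i Hi)).
    fold (I2 (xo i s) i) in P1; fold (I2 (xr i s) i) in P2.
    assert (Q1 : forall y, node M i < y < node M (S i) ->
      Rabs (error (fun y => Do 0%nat 0%nat y s) (omegah s) (S i) y - xo i s y) <= dl).
    { intros y Hy; unfold error, xo.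
      match goal with |- Rabs ?e <= _ =>
        replace e with (Do 0%nat 0%nat y s - Q Do 0%nat i s y) by ring end.
      apply BQo; [exact Hi | split; lra]. }
    assert (Q2 : forall y, node M i < y < node M (S i) ->
      Rabs (error (fun y => Dr 0%nat 0%nat y s) (rhoh s) (S i) y - xr i s y) <= dl).
    { intros y Hy; unfold error, xr.
      match goal with |- Rabs ?e <= _ =>
        replace e with (Dr 0%nat 0%nat y s - Q Dr 0%nat i s y) by ring end.
      apply BQr; [exact Hi | split; lra]. }
    specialize (P1 Q1); specialize (P2 Q2); lra.
  - unfold no, nr; rewrite !L2norm_sqr by assumption.
    replace (4 * L * dl ^ 2) with (L * (4 * dl ^ 2)) by ring.
    rewrite <- SL, <- !bsum_plus, <- !bsum_scal, <- !bsum_plus; apply bsum_le; intros i Hi.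
    assert (X := node_lt M i Hi).
    assert (P1 := RInt_square_perturb _ _ dl (xo i s) _ (Rlt_le _ _ X) (Cxo i Hi) (Ceo i Hi)).
    assert (P2 := RInt_square_perturb _ _ dl (xr i s) _ (Rlt_le _ _ X) (Cxr i Hi) (Cer i Hi)).
    fold (I2 (xo i s) i) in P1; fold (I2 (xr i s) i) in P2.
    assert (Q1 : forall y, node M i < y < node M (S i) ->
      Rabs (xo i s y - error (fun y => Do 0%nat 0%nat y s) (omegah s) (S i) y) <= dl).
    { intros y Hy; unfold error, xo; rewrite Rabs_minus_sym.
      match goal with |- Rabs ?e <= _ =>
        replace e with (Do 0%nat 0%nat y s - Q Do 0%nat i s y) by ring end.
      apply BQo; [exact Hi | split; lra]. }
    assert (Q2 : forall y, node M i < y < node M (S i) ->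
      Rabs (xr i s y - error (fun y => Dr 0%nat 0%nat y s) (rhoh s) (S i) y) <= dl).
    { intros y Hy; unfold error, xr; rewrite Rabs_minus_sym.
      match goal with |- Rabs ?e <= _ =>
        replace e with (Dr 0%nat 0%nat y s - Q Dr 0%nat i s y) by ring end.
      apply BQr; [exact Hi | split; lra]. }
    specialize (P1 Q1); specialize (P2 Q2); lra.
  - exact (L2norm_le_sup M _ ep Ceu Hep Beu).
Qed.

(** * Choice of the constants and conclusion *)

Lemma common_bound (a b a' b' : R) (l : list (R -> R -> R)) :
  (forall f, In f l ->
     continuous_on (fun p : R * R => Icc a b (fst p) /\ Icc a' b' (snd p))
       (fun p : R * R => f (fst p) (snd p))) ->
  exists B, 0 <= B /\ forall f, In f l ->
    forall x y, Icc a b x -> Icc a' b' y -> Rabs (f x y) <= B.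
Proof.
  induction l as [|f l IH]; intros H.
  - exists 0; split; [lra | intros f []].
  - destruct IH as [B [HB IH]]; [intros; apply H; right; assumption|].
    destruct (continuous_on_rectangle_bounded a b a' b' f) as [B' H'];
      [apply H; left; reflexivity|].
    exists (Rmax B B'); split; [eapply Rle_trans; [exact HB | apply Rmax_l]|].
    intros h [<-|Hh] x y Hx Hy.
    + eapply Rle_trans; [apply H'; assumption | apply Rmax_r].
    + eapply Rle_trans; [apply IH; assumption | apply Rmax_l].
Qed.

Theorem theorem2p5 :
  forall (k : nat) (yL yR T : R) (g : R -> R) (u rho omega : R -> R -> R),
    yL < yR -> 0 < T ->
    smooth_solution yL yR T g u rho omega ->
    forall kappa C0 : R,
    exists C : R, 0 < C /\
      forall (M : mesh yL yR) (uh rhoh omegah : R -> broken),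
        hmax M / hmin M <= kappa ->
        dg_solution M k T g uh rhoh omegah ->
        total_error M u rho omega uh rhoh omegah 0 <= C0 * hmax M ^ (k + 1) ->
        forall s : R, 0 <= s <= T ->
          total_error M u rho omega uh rhoh omegah s <= C * hmax M ^ (k + 1).
Proof.
  intros k yL yR T g u rho omega HLR HT [Su Sr So Pr Po Pu PD] kappa C0.
  destruct Su as [Du [Eu Hu]]; destruct Sr as [Dr [Er Hr]]; destruct So as [Do [Eo Ho]].
  destruct (dg_energy k) as [K [HK EN]].
  assert (FDu : derivative_family yL yR T Du) by (intros i j; apply (proj2 (Hu i j))).
  assert (FDr : derivative_family yL yR T Dr) by (intros i j; apply (proj2 (Hr i j))).
  assert (FDo : derivative_family yL yR T Do) by (intros i j; apply (proj2 (Ho i j))).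
  (* B must bound the solution itself for the nonlinear terms, and the y-derivatives of order k + 1
     of u, omega, rho, omega_s and rho_s for the Taylor remainders. *)
  destruct (common_bound yL yR 0 T
    [Du 0%nat 0%nat; Do 0%nat 0%nat; Dr 0%nat 0%nat; Du (S k) 0%nat;
     Do (S k) 0%nat; Dr (S k) 0%nat; Do (S k) 1%nat; Dr (S k) 1%nat]) as [B [HB BD]].
  { intros f Hf; simpl in Hf; repeat destruct Hf as [<-|Hf]; try contradiction;
      first [apply Hu | apply Ho | apply Hr]. }
  assert (EQ : forall y s, yL < y < yR -> Icc 0 T s ->
         Dr 0%nat 1%nat y s = - (Du 0%nat 0%nat y s * Do 0%nat 0%nat y s) /\
         Do 0%nat 1%nat y s = Dr 0%nat 0%nat y s * Du 0%nat 0%nat y s /\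
         Du 1%nat 0%nat y s = Do 0%nat 0%nat y s).
  { intros y s Hy Hs; assert (Iy : Icc yL yR y) by (split; lra).
    rewrite Eu, Eo, Er by assumption; repeat split.
    - apply (has_deriv_in_unique 0 T (fun t => rho y t) s); auto.
      apply (has_deriv_in_ext _ (fun t => Dr 0%nat 0%nat y t)); auto.
      apply (FDr 0%nat 0%nat y s Iy Hs).
    - apply (has_deriv_in_unique 0 T (fun t => omega y t) s); auto.
      apply (has_deriv_in_ext _ (fun t => Do 0%nat 0%nat y t)); auto.
      apply (FDo 0%nat 0%nat y s Iy Hs).
    - apply (has_deriv_in_unique yL yR (fun z => u z s) y); auto.
      apply (has_deriv_in_ext _ (fun z => Du 0%nat 0%nat z s)); auto.
      apply (FDu 0%nat 0%nat y s Iy Hs). }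
  assert (BC : forall s, Icc 0 T s -> Du 0%nat 0%nat yR s = g s)
    by (intros s Hs; rewrite Eu by (auto; split; lra); auto).
  set (L := yR - yL); assert (HL : 0 < L) by (unfold L; lra).
  set (m := 1 + 2 * B + B * L ^ (k + 1)).
  assert (Hm : 0 <= m).
  { assert (0 <= B * L ^ (k + 1)) by (apply Rmult_le_pos; [|apply pow_le]; lra).
    unfold m; lra. }
  (* The rate for E + h^(2k+2). It results from (K (z + dl) + dl)^2 <= 2 (K + 1)^2 (z^2 + dl^2),
     where z = sqrt L || omega - omega_h ||, and from z^2 <= L (2 E + 4 L dl^2). *)
  set (G := 2 * m * (1 + 2 * L * (K + 1) ^ 2 * (2 * L + (4 * L ^ 2 + 1) * B ^ 2))).
  (* The bracket bounds (E(0) + h^(2k+2)) / h^(2k+2): 4 C0^2 comes from twice the squares of two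
     initial errors, 4 L B^2 from the Taylor remainders, and 1 from the added h^(2k+2). *)
  set (A := (4 * C0 ^ 2 + 4 * L * B ^ 2 + 1) * exp (G * T)).
  (* Passing from E back to the errors of omega and rho costs a factor 2 and the Taylor remainders
     once more. *)
  set (Z := sqrt (2 * A + 4 * L * B ^ 2)).
  assert (HB2 : 0 <= B ^ 2) by apply pow2_ge_0.
  assert (HLB : 0 <= L * B ^ 2) by (apply Rmult_le_pos; lra).
  assert (HC2 : 0 <= C0 ^ 2) by apply pow2_ge_0.
  assert (HA : 0 < A) by (apply Rmult_lt_0_compat; [lra | apply exp_pos]).
  assert (HZ : 0 < Z) by (apply sqrt_lt_R0; lra).
  assert (HsL : 0 <= sqrt L) by apply sqrt_pos.
  assert (HG : 0 <= G).
  { apply Rmult_le_pos; [lra|].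
    assert (0 <= L * (K + 1) ^ 2) by (apply Rmult_le_pos; [lra | apply pow2_ge_0]).
    assert (0 <= L ^ 2 * B ^ 2) by (apply Rmult_le_pos; [apply pow2_ge_0 | lra]).
    assert (0 <= L * (K + 1) ^ 2 * (2 * L + (4 * L ^ 2 + 1) * B ^ 2))
      by (apply Rmult_le_pos; lra); lra. }
  (* The three summands are for u, omega and rho; the first is the sup bound for u with the bound
     [Z] on omega inserted. *)
  exists (sqrt L * (K * (sqrt L * Z + B)) + Z + Z); split.
  { assert (0 <= sqrt L * Z) by (apply Rmult_le_pos; lra).
    assert (0 <= K * (sqrt L * Z + B)) by (apply Rmult_le_pos; lra).
    assert (0 <= sqrt L * (K * (sqrt L * Z + B))) by (apply Rmult_le_pos; lra); lra. }
  intros M uh rhoh omegah _ DG INIT.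
  assert (TE : forall s, Icc 0 T s -> total_error M u rho omega uh rhoh omegah s
    = L2norm M (error (fun y => Du 0%nat 0%nat y s) (uh s))
      + L2norm M (error (fun y => Do 0%nat 0%nat y s) (omegah s))
      + L2norm M (error (fun y => Dr 0%nat 0%nat y s) (rhoh s))).
  { intros s Hs; unfold total_error; f_equal; [f_equal|]; apply L2norm_error_ext;
      intros; symmetry; auto. }
  destruct (EN yL yR T B g M Du Do Dr uh rhoh omegah HT HB FDu FDo FDr BD EQ BC DG)
    as [E [dE HE]].
  fold L in HE.
  set (H := hmax M ^ (k + 1)) in *.
  set (nu := fun s => L2norm M (error (fun y => Du 0%nat 0%nat y s) (uh s))) in *.
  set (no := fun s => L2norm M (error (fun y => Do 0%nat 0%nat y s) (omegah s))) in *.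
  set (nr := fun s => L2norm M (error (fun y => Dr 0%nat 0%nat y s) (rhoh s))) in *.
  assert (Nu : forall s, 0 <= nu s) by (intros s; unfold nu, no, nr; apply L2norm_nonneg).
  assert (No : forall s, 0 <= no s) by (intros s; unfold nu, no, nr; apply L2norm_nonneg).
  assert (Nr : forall s, 0 <= nr s) by (intros s; unfold nu, no, nr; apply L2norm_nonneg).
  assert (HH : 0 < H) by (apply pow_lt, hmax_bounds).
  assert (H2 : 0 < H ^ 2) by (apply pow_lt, HH).
  assert (I0 : Icc 0 T 0) by (split; lra).
  rewrite (TE 0 I0) in INIT; fold (nu 0) (no 0) (nr 0) in INIT.
  assert (Gi : forall s, Icc 0 T s -> dE s <= G * (E s + H ^ 2)).
  { intros s Hs; destruct (HE s Hs) as [_ [D1 [D2 [D3 _]]]].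
    fold (no s) (nr s) in D1, D3; fold m in D1.
    eapply Rle_trans; [exact D1|]; unfold G.
    rewrite (Rmult_assoc (2 * m)); apply Rmult_le_compat_l; [lra|].
    set (dl := B * H) in *; set (z := sqrt L * no s) in *.
    assert (Hdl : 0 <= dl) by (apply Rmult_le_pos; lra).
    assert (Hz : 0 <= z) by (apply Rmult_le_pos; auto).
    assert (z2 : z ^ 2 = L * no s ^ 2)
      by (unfold z; rewrite Rpow_mult_distr, pow2_sqrt by lra; reflexivity).
    assert (no2 : no s ^ 2 <= 2 * E s + 4 * L * dl ^ 2)
      by (assert (0 <= nr s ^ 2) by apply pow2_ge_0; lra).
    assert (S1 : (K * (z + dl) + dl) ^ 2 <= 2 * (K + 1) ^ 2 * (z ^ 2 + dl ^ 2)).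
    { apply Rle_trans with (((K + 1) * (z + dl)) ^ 2).
      - apply pow_incr; split; [|lra].
        assert (0 <= K * (z + dl)) by (apply Rmult_le_pos; lra); lra.
      - rewrite Rpow_mult_distr, (Rmult_comm 2), Rmult_assoc.
        apply Rmult_le_compat_l; [apply pow2_ge_0|].
        assert (0 <= (z - dl) ^ 2) by apply pow2_ge_0; lra. }
    assert (S2 : z ^ 2 + dl ^ 2 <= 2 * L * E s + (4 * L ^ 2 + 1) * B ^ 2 * H ^ 2).
    { rewrite z2; assert (L * no s ^ 2 <= L * (2 * E s + 4 * L * dl ^ 2))
        by (apply Rmult_le_compat_l; lra).
      replace ((4 * L ^ 2 + 1) * B ^ 2 * H ^ 2) with ((4 * L ^ 2 + 1) * dl ^ 2)
        by (unfold dl; ring); lra. }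
    set (W := 2 * L + (4 * L ^ 2 + 1) * B ^ 2).
    assert (0 <= (4 * L ^ 2 + 1) * B ^ 2)
      by (assert (0 <= L ^ 2) by apply pow2_ge_0; apply Rmult_le_pos; lra).
    assert (S3 : z ^ 2 + dl ^ 2 <= W * (E s + H ^ 2)).
    { assert (0 <= (4 * L ^ 2 + 1) * B ^ 2 * E s) by (apply Rmult_le_pos; lra).
      assert (0 <= L * H ^ 2) by (apply Rmult_le_pos; lra).
      unfold W; lra. }
    assert (S4 : 2 * L * (K + 1) ^ 2 * (z ^ 2 + dl ^ 2)
                 <= 2 * L * (K + 1) ^ 2 * (W * (E s + H ^ 2))).
    { apply Rmult_le_compat_l; [|exact S3].
      apply Rmult_le_pos; [lra | apply pow2_ge_0]. }
    assert (S5 : L * (K * (z + dl) + dl) ^ 2 <= L * (2 * (K + 1) ^ 2 * (z ^ 2 + dl ^ 2)))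
      by (apply Rmult_le_compat_l; lra).
    replace ((1 + 2 * L * (K + 1) ^ 2 * W) * (E s + H ^ 2))
      with (E s + H ^ 2 + 2 * L * (K + 1) ^ 2 * (W * (E s + H ^ 2))) by ring.
    lra. }
  intros s Hs.
  assert (GR := gronwall_Icc G (H ^ 2) T E dE (fun t Ht => proj1 (HE t Ht)) Gi s Hs).
  assert (E0 : E 0 + H ^ 2 <= (4 * C0 ^ 2 + 4 * L * B ^ 2 + 1) * H ^ 2).
  { destruct (HE 0 I0) as [_ [_ [_ [_ [D _]]]]].
    fold (no 0) (nr 0) in D.
    assert (Q : forall x, 0 <= x <= C0 * H -> x ^ 2 <= C0 ^ 2 * H ^ 2)
      by (intros x Hx; rewrite <- Rpow_mult_distr; apply pow_incr, Hx).
    assert (X1 := Q (no 0) ltac:(specialize (Nu 0); specialize (No 0); specialize (Nr 0); lra)).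
    assert (X2 := Q (nr 0) ltac:(specialize (Nu 0); specialize (No 0); specialize (Nr 0); lra)).
    rewrite Rpow_mult_distr in D; lra. }
  assert (EA : E s + H ^ 2 <= A * H ^ 2).
  { eapply Rle_trans; [exact GR|].
    replace (A * H ^ 2) with ((4 * C0 ^ 2 + 4 * L * B ^ 2 + 1) * H ^ 2 * exp (G * T))
      by (unfold A; ring).
    destruct (HE 0 I0) as [_ [_ [D2 _]]].
    apply Rmult_le_compat; [lra | apply Rlt_le, exp_pos | exact E0|].
    assert (GT : G * s <= G * T) by (apply Rmult_le_compat_l; lra).
    destruct GT as [GT|GT]; [apply Rlt_le, exp_increasing, GT | rewrite GT; lra]. }
  destruct (HE s Hs) as [_ [_ [_ [D3 [_ D5]]]]].
  fold (no s) (nr s) in D3; fold (nu s) (no s) in D5.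
  assert (NZ : no s ^ 2 + nr s ^ 2 <= (Z * H) ^ 2).
  { rewrite Rpow_mult_distr; unfold Z; rewrite pow2_sqrt by lra.
    rewrite Rpow_mult_distr in D3; lra. }
  assert (ZH : 0 <= Z * H) by (apply Rmult_le_pos; lra).
  assert (RT : forall x y, 0 <= x -> x ^ 2 + y ^ 2 <= (Z * H) ^ 2 -> x <= Z * H).
  { intros x y Hx Hxy; apply Rsqr_incr_0_var; [|exact ZH].
    assert (0 <= y ^ 2) by apply pow2_ge_0; rewrite !Rsqr_pow2; lra. }
  assert (N1 := RT (no s) (nr s) (No s) NZ).
  assert (N2 := RT (nr s) (no s) (Nr s) ltac:(lra)).
  rewrite (TE s Hs); fold (nu s) (no s) (nr s).
  assert (N3 : nu s <= sqrt L * (K * (sqrt L * (Z * H) + B * H))).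
  { eapply Rle_trans; [exact D5|].
    apply Rmult_le_compat_l; [exact HsL|]; apply Rmult_le_compat_l; [lra|].
    apply Rplus_le_compat_r, Rmult_le_compat_l; assumption. }
  lra.
Qed.
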